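(* Let $k$ be fixed, $N=N(n)$, and let $P_n\in M_k\otimes M_n$ be orthogonal projections of rank $N$, $P_n=V_nV_n^*$, defining channels $\Psi_n(X)=(\mathrm{id}_k\otimes\mathrm{Tr}_n)(V_nXV_n^* )$, $\Psi_n:M_N\to M_k$. Suppose the family $(P_n,\ E_{ij}\otimes I_n:\ i,j\in\{1,\dots,k\})$, viewed in $(M_{kn},(kn)^{-1}\mathrm{Tr})$, converges strongly in distribution as $n\to\infty$. Then for any quantum channel $\Xi:M_p\to M_q$ there exists a compact convex set $K\subset D_{kq}$ such that, with $K_n=(\Xi\otimes\Psi_n)(D_{pN})$, $$K^\circ\subseteq\liminf_{n\to\infty}K_n\subseteq\limsup_{n\to\infty}K_n\subseteq K.$$
   Context: $E_{ij}$ are the matrix units of $M_k$. A sequence of tuples $(a_1^{(n)},\dots,a_r^{(n)})$ of matrices in $(M_d,d^{-1}\mathrm{Tr})$ converges in distribution to a tuple $(a_1,\dots,a_r)$ in a $*$-probability space $(\mathcal A,\phi)$ if $\phi_n(Q(a^{(n)}))\to\phi(Q(a))$ for every non-commutative $*$-polynomial $Q$; it converges strongly if moreover $\|Q(a^{(n)})\|\to\|Q(a)\|$ (operator norms, the limiting one being $\lim_p\|Q(a)\|_p$) for every such $Q$. $D_d$ is the set of $d\times d$ density matrices. For sets, $\liminf_nS_n=\bigcup_N\bigcap_{n\ge N}S_n$, $\limsup_nS_n=\bigcap_N\bigcup_{n\ge N}S_n$; $K^\circ$ is the interior of $K$ relative to the affine space of trace-one Hermitian matrices. *)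

(* Defs.v *)
From HB Require Import structures.
From mathcomp Require Import all_boot all_order all_algebra.
From mathcomp Require Import all_classical all_reals all_analysis.
From mathcomp Require Import complex mxtens.

Set Implicit Arguments.
Unset Strict Implicit.
Unset Printing Implicit Defensive.

Import Order.TTheory GRing.Theory Num.Theory numFieldNormedType.Exports.
Local Open Scope ring_scope.
Local Open Scope classical_set_scope.

Section QDefs.
Variable R : realType.
Local Notation C := (R[i]).

Definition adjmx m n (A : 'M[C]_(m, n)) : 'M[C]_(n, m) :=
  \matrix_(i, j) conjc (A j i).

Definition hermitian m (A : 'M[C]_m) : Prop := adjmx A = A.

Definition psd m (A : 'M[C]_m) : Prop :=
  hermitian A /\ forall v : 'cV[C]_m, 0 <= (adjmx v *m A *m v) 0 0.

Definition density m : set 'M[C]_m := [set A | psd A /\ \tr A = 1].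

Definition orth_proj m (A : 'M[C]_m) : Prop := hermitian A /\ A *m A = A.

(** Block (a,b) of X in M_p (x) M_n, with the Kronecker indexing of mxtens
    (index (a,c) <-> a * n + c), consistent with [*t]. *)
Definition mxblock p n (X : 'M[C]_(p * n)) (a b : 'I_p) : 'M[C]_n :=
  \matrix_(c, d) X (mxtens_index (a, c)) (mxtens_index (b, d)).

(** (f (x) g)(X) = sum_{a,b} f(E_ab) (x) g(X_ab), for X = sum E_ab (x) X_ab *)
Definition tmap p q n r (f : 'M[C]_p -> 'M[C]_q) (g : 'M[C]_n -> 'M[C]_r)
  (X : 'M[C]_(p * n)) : 'M[C]_(q * r) :=
  \sum_(a < p) \sum_(b < p) (f (delta_mx a b) *t g (mxblock X a b)).

Definition ptrace2 k n (Y : 'M[C]_(k * n)) : 'M[C]_k :=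
  \matrix_(i, j) \sum_(l < n) Y (mxtens_index (i, l)) (mxtens_index (j, l)).

Definition Psi k n N (V : 'M[C]_(k * n, N)) (X : 'M[C]_N) : 'M[C]_k :=
  ptrace2 (V *m X *m adjmx V).

Definition completely_positive p q (f : 'M[C]_p -> 'M[C]_q) : Prop :=
  forall m (X : 'M[C]_(m * p)), psd X -> psd (tmap id f X).
Definition trace_preserving p q (f : 'M[C]_p -> 'M[C]_q) : Prop :=
  forall X, \tr (f X) = \tr X.

Definition hsnorm m n (A : 'M[C]_(m, n)) : R :=
  Num.sqrt (\sum_(i < m) \sum_(j < n) (complex.Re (A i j) ^+ 2 + complex.Im (A i j) ^+ 2)).
Definition mdist m (A B : 'M[C]_m) : R := hsnorm (A - B).

Definition opnorm m (A : 'M[C]_m) : R :=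
  sup [set r | exists v : 'cV[C]_m, hsnorm v = 1 /\ r = hsnorm (A *m v)].

Definition openM m (U : set 'M[C]_m) : Prop :=
  forall X, U X -> exists e : R, 0 < e /\ forall Y, mdist X Y < e -> U Y.

Definition compactM m (K : set 'M[C]_m) : Prop :=
  forall (I : Type) (U : I -> set 'M[C]_m), (forall i, openM (U i)) ->
    (forall X, K X -> exists i, U i X) ->
    exists (r : nat) (f : 'I_r -> I), forall X, K X -> exists j, U (f j) X.

Definition convexM m (K : set 'M[C]_m) : Prop :=
  forall X Y (t : R), K X -> K Y -> 0 <= t -> t <= 1 ->
    K ((t%:C)%C *: X + ((1 - t)%:C)%C *: Y).

Definition aff1 m : set 'M[C]_m := [set A | hermitian A /\ \tr A = 1].
Definition relint m (K : set 'M[C]_m) : set 'M[C]_m :=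
  [set X | aff1 X /\ exists e : R, 0 < e /\
     forall Y, aff1 Y -> mdist X Y < e -> K Y].

Definition ntrace d (A : 'M[C]_d) : C := (d%:R)^-1 * \tr A.

Definition ccvg (u : nat -> C) (l : C) : Prop :=
  ((fun n => complex.Re (u n)) @ \oo --> complex.Re l) /\ ((fun n => complex.Im (u n)) @ \oo --> complex.Im l).

End QDefs.

Definition set_liminf T (S : nat -> set T) : set T :=
  [set x | exists N, forall n, (N <= n)%N -> S n x].
Definition set_limsup T (S : nat -> set T) : set T :=
  [set x | forall N, exists n, (N <= n)%N /\ S n x].

Inductive ncpoly (C V : Type) : Type :=
| NCConst of C
| NCVar of V
| NCVarStar of V
| NCAdd of ncpoly C V & ncpoly C V
| NCMul of ncpoly C V & ncpoly C V.

Arguments NCConst {C V}. Arguments NCVar {C V}. Arguments NCVarStar {C V}.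
Arguments NCAdd {C V}. Arguments NCMul {C V}.

Fixpoint ncstar (R : rcfType) V (Q : ncpoly R[i] V) : ncpoly R[i] V :=
  match Q with
  | NCConst c => NCConst (conjc c)
  | NCVar v => NCVarStar v
  | NCVarStar v => NCVar v
  | NCAdd Q1 Q2 => NCAdd (ncstar Q1) (ncstar Q2)
  | NCMul Q1 Q2 => NCMul (ncstar Q2) (ncstar Q1)
  end.

Fixpoint ncpow C V (one : C) (Q : ncpoly C V) (m : nat) : ncpoly C V :=
  match m with
  | O => NCConst one
  | S m' => NCMul Q (ncpow one Q m')
  end.

Fixpoint nceval (R : realType) V d (a : V -> 'M[R[i]]_d) (Q : ncpoly R[i] V)
  : 'M[R[i]]_d :=
  match Q with
  | NCConst c => c%:M
  | NCVar v => a v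
  | NCVarStar v => adjmx (a v)
  | NCAdd Q1 Q2 => nceval a Q1 + nceval a Q2
  | NCMul Q1 Q2 => nceval a Q1 *m nceval a Q2
  end.

Definition ptuple (R : realType) k n (P : 'M[R[i]]_(k * n))
  (o : option ('I_k * 'I_k)) : 'M[R[i]]_(k * n) :=
  match o with
  | None => P
  | Some ij => (delta_mx ij.1 ij.2 : 'M[R[i]]_k) *t (1%:M : 'M[R[i]]_n)
  end.

(** Strong convergence in distribution of a sequence of tuples a n of
    d n x d n matrices: there is a limit distribution mu (the values
    phi(Q(a)) of the limit tuple) such that all normalized traces converge
    to mu, and the operator norms converge to the limiting norm
    lim_{p -> oo} ||Q(a)||_p, computed along p = 2m as
    phi((Q^* Q)^m)^(1/(2m)). *)
Definition strong_conv (R : realType) V (d : nat -> nat)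
  (a : forall n, V -> 'M[R[i]]_(d n)) : Prop :=
  exists mu : ncpoly R[i] V -> R[i],
    (forall Q, ccvg (fun n => ntrace (nceval (a n) Q)) (mu Q)) /\
    (forall Q, exists L : R,
       ((fun m : nat => powR (complex.Re (mu (ncpow 1 (NCMul (ncstar Q) Q) m)))
                            ((m.*2)%:R)^-1) @ \oo --> L) /\
       ((fun n => opnorm (nceval (a n) Q)) @ \oo --> L)).

(* Main.v *)
Require Import Defs.
From HB Require Import structures.
From mathcomp Require Import all_boot all_order all_algebra.
From mathcomp Require Import all_classical all_reals all_analysis.
From mathcomp Require Import complex mxtens.
From mathcomp Require Import ring lra.
Import Order.TTheory GRing.Theory Num.Theory numFieldNormedType.Exports.
Import ComplexField.Normc.
Local Open Scope ring_scope.
Local Open Scope classical_set_scope.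

Set Implicit Arguments.
Unset Strict Implicit.
Unset Printing Implicit Defensive.

Local Notation Re := complex.Re.
Local Notation Im := complex.Im.
Local Notation mdist := Defs.mdist.
Local Notation mxblock := Defs.mxblock.
Local Notation hermitian := Defs.hermitian.

(* The support function of K_n at a Hermitian A is, after shifting A by a large
   multiple of the identity, the operator norm of a positive block matrix
   T_n = [P_n (B_ab (x) 1) P_n]_ab in M_p(M_kn) with blocks that are fixed
   polynomials in the tuple.  For S = T_n^(2^i) the norms of S and of the partial
   trace sum_a S_aa agree up to a factor p, and the latter is the norm of a scalar
   polynomial, which converges by strong convergence; letting i grow, the factor
   p^(2^(-i)) disappears and ||T_n|| converges.  Pointwise convergence of the
   support functions is uniform by compactness, so the convex compact sets K_n are
   Cauchy for the Hausdorff distance.  K is their limit: an interior point Y of K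
   outside K_n could be pushed away from its nearest point in K_n, staying in K
   but at a definite distance from K_n. *)

(** * Frobenius inner product and operator norm *)

(** The quadratic is evaluated at its minimum [- b / c]. It yields two Cauchy-Schwarz inequalities:
    one for [frob], one for the semi-inner product of a positive matrix. *)
Lemma discriminant_le0 (R : realFieldType) (a b c : R) :
  0 <= c -> (forall t, 0 <= a + 2 * b * t + c * t ^+ 2) -> b ^+ 2 <= a * c.
Proof.
move=> c0 h; have [cz|cn] := eqVneq c 0.
  have [->|bn] := eqVneq b 0; first by rewrite cz mulr0 expr0n.
  (* With [c = 0] the function is affine; at this point a nonzero slope would give it the value
     [-1]. *)
  have := h (- (a + 1) / (2 * b)).
  have -> : a + 2 * b * (- (a + 1) / (2 * b)) + c * (- (a + 1) / (2 * b)) ^+ 2 = -1.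
    by rewrite cz; field.
  by lra.
have cp : 0 < c by rewrite lt_def cn.
have := h (- b / c).
have -> : a + 2 * b * (- b / c) + c * (- b / c) ^+ 2 = (a * c - b ^+ 2) / c by field.
by rewrite pmulr_lge0 ?invr_gt0// subr_ge0.
Qed.

Section Frobenius.
Variable R : realType.
Local Notation C := R[i].

Lemma ReD (x y : C) : Re (x + y) = Re x + Re y.
Proof. by case: x y => [a b] [c d]. Qed.

Lemma ReN (x : C) : Re (- x) = - Re x.
Proof. by case: x. Qed.

Lemma Re_sum I (s : seq I) (F : I -> C) : Re (\sum_(i <- s) F i) = \sum_(i <- s) Re (F i).
Proof. by apply: (big_morph _ ReD). Qed.

Lemma Re_trace_sum m I (s : seq I) (F : I -> 'M[C]_m) :
  Re (\tr (\sum_(i <- s) F i)) = \sum_(i <- s) Re (\tr (F i)).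
Proof. by rewrite -Re_sum; congr Re; exact: raddf_sum. Qed.

Lemma ReJ (x : C) : Re (conjc x) = Re x.
Proof. by case: x. Qed.

Lemma ReZ (t : R) (x : C) : Re (t%:C%C * x) = t * Re x.
Proof. by case: x => a b /=; rewrite mul0r subr0. Qed.

Lemma adjmxK m n (A : 'M[C]_(m, n)) : adjmx (adjmx A) = A.
Proof. by apply/matrixP=> i j; rewrite !mxE conjcK. Qed.

Lemma adjmxD m n (A B : 'M[C]_(m, n)) : adjmx (A + B) = adjmx A + adjmx B.
Proof. by apply/matrixP=> i j; rewrite !mxE rmorphD. Qed.

Lemma adjmxN m n (A : 'M[C]_(m, n)) : adjmx (- A) = - adjmx A.
Proof. by apply/matrixP=> i j; rewrite !mxE rmorphN. Qed.

Lemma adjmxZ m n c (A : 'M[C]_(m, n)) : adjmx (c *: A) = conjc c *: adjmx A.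
Proof. by apply/matrixP=> i j; rewrite !mxE rmorphM. Qed.

Lemma adjmxM m n p (A : 'M[C]_(m, n)) (B : 'M[C]_(n, p)) :
  adjmx (A *m B) = adjmx B *m adjmx A.
Proof.
apply/matrixP=> i j; rewrite !mxE rmorph_sum; apply: eq_bigr => l _.
by rewrite !mxE rmorphM mulrC.
Qed.

Lemma adjmx1 n : adjmx (1%:M : 'M[C]_n) = 1%:M.
Proof. by apply/matrixP=> i j; rewrite !mxE rmorph_nat eq_sym. Qed.

Lemma trace_adjmx n (A : 'M[C]_n) : \tr (adjmx A) = conjc (\tr A).
Proof. by rewrite /mxtrace rmorph_sum; apply: eq_bigr => i _; rewrite mxE. Qed.

(** Real part of the Hilbert-Schmidt inner product: it makes the complex matrices a real Euclidean
    space with norm [hsnorm], the setting for support functions and nearest points. *)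
Definition frob m n (A B : 'M[C]_(m, n)) : R := Re (\tr (adjmx A *m B)).

Lemma frobC m n (A B : 'M[C]_(m, n)) : frob A B = frob B A.
Proof. by rewrite /frob -[LHS]ReJ -trace_adjmx adjmxM adjmxK. Qed.

Lemma frobDr m n (A B D : 'M[C]_(m, n)) : frob A (B + D) = frob A B + frob A D.
Proof. by rewrite /frob mulmxDr mxtraceD ReD. Qed.

Lemma frobNr m n (A B : 'M[C]_(m, n)) : frob A (- B) = - frob A B.
Proof. by rewrite /frob mulmxN raddfN ReN. Qed.

Lemma frobBr m n (A B D : 'M[C]_(m, n)) : frob A (B - D) = frob A B - frob A D.
Proof. by rewrite frobDr frobNr. Qed.

Lemma frobZr m n t (A B : 'M[C]_(m, n)) : frob A (t%:C%C *: B) = t * frob A B.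
Proof. by rewrite /frob -scalemxAr mxtraceZ ReZ. Qed.

Lemma frobDl m n (A B D : 'M[C]_(m, n)) : frob (A + B) D = frob A D + frob B D.
Proof. by rewrite frobC frobDr !(frobC D). Qed.

Lemma frobNl m n (A B : 'M[C]_(m, n)) : frob (- A) B = - frob A B.
Proof. by rewrite frobC frobNr (frobC B). Qed.

Lemma frobBl m n (A B D : 'M[C]_(m, n)) : frob (A - B) D = frob A D - frob B D.
Proof. by rewrite frobDl frobNl. Qed.

Lemma frobZl m n t (A B : 'M[C]_(m, n)) : frob (t%:C%C *: A) B = t * frob A B.
Proof. by rewrite frobC frobZr frobC. Qed.

Lemma frob_mulmx m n p (A : 'M[C]_(m, n)) (B : 'M[C]_(m, p)) (D : 'M[C]_(p, n)) :
  frob A (B *m D) = frob (adjmx B *m A) D.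
Proof. by rewrite /frob adjmxM adjmxK mulmxA. Qed.

Lemma frobAE m n (A : 'M[C]_(m, n)) :
  frob A A = \sum_i \sum_j (Re (A i j) ^+ 2 + Im (A i j) ^+ 2).
Proof.
rewrite /frob /mxtrace Re_sum exchange_big /=; apply: eq_bigr => j _.
rewrite mxE Re_sum; apply: eq_bigr => i _; rewrite mxE.
by case: (A i j) => a b /=; rewrite mulNr opprK -!expr2.
Qed.

Lemma frob_ge0 m n (A : 'M[C]_(m, n)) : 0 <= frob A A.
Proof.
by rewrite frobAE; do 2 (apply: sumr_ge0 => ? _); rewrite addr_ge0 ?sqr_ge0.
Qed.

Lemma hsnormE m n (A : 'M[C]_(m, n)) : hsnorm A = Num.sqrt (frob A A).
Proof. by rewrite frobAE. Qed.

Lemma sqr_hsnorm m n (A : 'M[C]_(m, n)) : hsnorm A ^+ 2 = frob A A.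
Proof. by rewrite hsnormE sqr_sqrtr ?frob_ge0. Qed.

Lemma hsnorm_ge0 m n (A : 'M[C]_(m, n)) : 0 <= hsnorm A.
Proof. exact: sqrtr_ge0. Qed.

Lemma le_hsnorm m n p q (A : 'M[C]_(m, n)) (B : 'M[C]_(p, q)) (c : R) :
  0 <= c -> frob A A <= c ^+ 2 * frob B B -> hsnorm A <= c * hsnorm B.
Proof.
move=> c0 h; rewrite -ler_sqr ?nnegrE ?mulr_ge0 ?hsnorm_ge0//.
by rewrite exprMn !sqr_hsnorm.
Qed.

Lemma normc_le_hsnorm m n (A : 'M[C]_(m, n)) i j : normc (A i j) <= hsnorm A.
Proof.
rewrite hsnormE frobAE (bigD1 i)//= (bigD1 j)//= -addrA.
case: (A i j) => a b /=; rewrite ler_wsqrtr// lerDl addr_ge0//.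
  by apply: sumr_ge0 => ? _; rewrite addr_ge0 ?sqr_ge0.
by do 2 (apply: sumr_ge0 => ? _); rewrite addr_ge0 ?sqr_ge0.
Qed.

Lemma hsnorm_eq0 m n (A : 'M[C]_(m, n)) : hsnorm A = 0 -> A = 0.
Proof.
move=> h; apply/matrixP=> i j; rewrite mxE; apply/eq0_normc/eqP.
by rewrite eq_le -{1}h normc_le_hsnorm; case: (A i j) => a b; apply: sqrtr_ge0.
Qed.

Lemma frob_CS m n (A B : 'M[C]_(m, n)) : frob A B <= hsnorm A * hsnorm B.
Proof.
apply: (le_trans (ler_norm _)).
rewrite -ler_sqr ?nnegrE ?mulr_ge0 ?hsnorm_ge0// exprMn !sqr_hsnorm real_normK ?num_real//.
apply: discriminant_le0 => [|t]; first exact: frob_ge0.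
suff <- : frob (A + t%:C%C *: B) (A + t%:C%C *: B) =
    frob A A + 2 * frob A B * t + frob B B * t ^+ 2 by exact: frob_ge0.
by rewrite frobDl !frobDr !frobZl !frobZr (frobC B A); ring.
Qed.

Lemma hsnormD m n (A B : 'M[C]_(m, n)) : hsnorm (A + B) <= hsnorm A + hsnorm B.
Proof.
rewrite -ler_sqr ?nnegrE ?addr_ge0 ?hsnorm_ge0// sqrrD !sqr_hsnorm.
rewrite frobDl !frobDr (frobC B A).
by have := frob_CS A B; lra.
Qed.

Lemma hsnormN m n (A : 'M[C]_(m, n)) : hsnorm (- A) = hsnorm A.
Proof. by rewrite !hsnormE frobNl frobNr opprK. Qed.

Lemma hsnorm0 m n : hsnorm (0 : 'M[C]_(m, n)) = 0.
Proof. by rewrite hsnormE /frob mulmx0 raddf0 /= sqrtr0. Qed.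

Lemma hsnormZ m n c (A : 'M[C]_(m, n)) : hsnorm (c *: A) = normc c * hsnorm A.
Proof.
rewrite !hsnormE; case: c => a b /=.
rewrite -sqrtrM ?addr_ge0 ?sqr_ge0// !frobAE mulr_sumr; congr Num.sqrt.
apply: eq_bigr => i _; rewrite mulr_sumr; apply: eq_bigr => j _; rewrite mxE.
by case: (A i j) => x y /=; ring.
Qed.

Lemma hsnormZr m n t (A : 'M[C]_(m, n)) : hsnorm (t%:C%C *: A) = `|t| * hsnorm A.
Proof. by rewrite hsnormZ /= expr0n addr0 sqrtr_sqr. Qed.

Lemma hsnorm_sum m n I (s : seq I) (F : I -> 'M[C]_(m, n)) :
  hsnorm (\sum_(i <- s) F i) <= \sum_(i <- s) hsnorm (F i).
Proof.
elim/big_ind2: _ => [|x1 x2 y1 y2 h1 h2|//]; first by rewrite hsnorm0.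
by apply: (le_trans (hsnormD _ _)); rewrite lerD.
Qed.

Lemma hsdistC m (A B : 'M[C]_m) : mdist A B = mdist B A.
Proof. by rewrite /mdist -hsnormN opprB. Qed.

Lemma hsdist_triangle m (A B D : 'M[C]_m) : mdist A D <= mdist A B + mdist B D.
Proof.
rewrite /Defs.mdist (_ : A - D = (A - B) + (B - D)) ?hsnormD//.
by rewrite addrA subrK.
Qed.

Lemma hsdist_ge0 m (A B : 'M[C]_m) : 0 <= mdist A B.
Proof. exact: hsnorm_ge0. Qed.

Lemma hsdistxx m (A : 'M[C]_m) : mdist A A = 0.
Proof. by rewrite /mdist subrr hsnorm0. Qed.

Lemma linear_bounded m n p q (f : {linear 'M[C]_(m, n) -> 'M[C]_(p, q)}) :
  exists2 c, 0 <= c & forall X, hsnorm (f X) <= c * hsnorm X.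
Proof.
exists (\sum_i \sum_j hsnorm (f (delta_mx i j))).
  by do 2 (apply: sumr_ge0 => ? _); exact: hsnorm_ge0.
move=> X; rewrite {1}[X]matrix_sum_delta linear_sum.
apply: (le_trans (hsnorm_sum _ _)); rewrite mulr_suml; apply: ler_sum => i _.
rewrite linear_sum; apply: (le_trans (hsnorm_sum _ _)).
rewrite mulr_suml; apply: ler_sum => j _.
by rewrite linearZ hsnormZ mulrC ler_wpM2l ?hsnorm_ge0 ?normc_le_hsnorm.
Qed.

(** * The operator norm as a supremum over unit vectors *)

Section OperatorNorm.
Variable m : nat.
Implicit Types A T : 'M[C]_m.

Lemma opnorm_set_ub A : exists2 c, 0 <= c &
  ubound [set r | exists v : 'cV[C]_m, hsnorm v = 1 /\ r = hsnorm (A *m v)] c.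
Proof.
have [c c0 hc] := linear_bounded (mulmx A : {linear 'M[C]_(m, 1) -> 'M[C]_(m, 1)}).
exists c => // r [v [v1 ->]].
by have := hc v; rewrite v1 mulr1.
Qed.

Lemma opnorm_bound A (v : 'cV[C]_m) : hsnorm (A *m v) <= opnorm A * hsnorm v.
Proof.
have [v0|vn] := eqVneq (hsnorm v) 0.
  by rewrite (hsnorm_eq0 v0) mulmx0 hsnorm0 mulr0.
have vp : 0 < hsnorm v by rewrite lt_def vn hsnorm_ge0.
pose u := ((hsnorm v)^-1)%:C%C *: v.
have u1 : hsnorm u = 1.
  by rewrite hsnormZr ger0_norm ?invr_ge0 ?hsnorm_ge0// mulVf.
have : hsnorm (A *m u) <= opnorm A.
  have [c c0 hc] := opnorm_set_ub A.
  by apply: ub_le_sup; [exists c | exists u].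
rewrite -scalemxAr hsnormZr ger0_norm ?invr_ge0 ?hsnorm_ge0//.
by rewrite mulrC ler_pdivrMr.
Qed.

Lemma opnorm_le A c : 0 <= c ->
  (forall v : 'cV[C]_m, hsnorm (A *m v) <= c * hsnorm v) -> opnorm A <= c.
Proof.
move=> c0 h; rewrite /opnorm; set S := [set _ | _].
(* For [m = 0] there is no unit vector, and the supremum of the empty set is [0]. *)
have [->|/set0P S0] := eqVneq S set0; first by rewrite sup0.
by apply: ge_sup => // r [v [v1 ->]]; rewrite (le_trans (h v))// v1 mulr1.
Qed.

Lemma opnorm_ge0 A : 0 <= opnorm A.
Proof.
rewrite /opnorm; set S := [set _ | _].
have [->|/set0P [r Sr]] := eqVneq S set0; first by rewrite sup0.
have [c c0 hc] := opnorm_set_ub A.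
apply: (@le_trans _ _ r); last by apply: ub_le_sup => //; exists c.
by case: Sr => v [_ ->]; exact: hsnorm_ge0.
Qed.

(** The C*-identity: the inequality that is not submultiplicativity comes from [||T v||^2 = <v, T^2
    v> <= ||T^2|| ||v||^2]. *)
Lemma opnorm_sqr T : hermitian T -> opnorm (T *m T) = opnorm T ^+ 2.
Proof.
move=> hT; apply/eqP; rewrite eq_le; apply/andP; split.
  apply: opnorm_le => [|v]; first exact: sqr_ge0.
  rewrite -mulmxA (le_trans (opnorm_bound _ _))// expr2 -mulrA.
  by rewrite ler_wpM2l ?opnorm_ge0 ?opnorm_bound.
rewrite -[leRHS]sqr_sqrtr ?opnorm_ge0// ler_sqr ?nnegrE ?opnorm_ge0 ?sqrtr_ge0//.
apply: opnorm_le => [|v]; first exact: sqrtr_ge0.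
apply: le_hsnorm; first exact: sqrtr_ge0.
rewrite sqr_sqrtr ?opnorm_ge0// -{1}hT -frob_mulmx mulmxA.
rewrite (le_trans (frob_CS _ _))// -sqr_hsnorm mulrC expr2 mulrA.
by rewrite ler_wpM2r ?hsnorm_ge0 ?opnorm_bound.
Qed.

End OperatorNorm.
End Frobenius.

(** * Compactness and nearest points *)

Lemma coord_le_norm (R : realType) n (y : 'rV[R]_n) l : `|y 0 l| <= `|y|.
Proof.
rewrite [leRHS]/Num.norm /= mx_normrE.
by apply/bigmax_geP; right => /=; exists (0, l).
Qed.

Lemma norm_le_coord (R : realType) n (y : 'rV[R]_n) c : 0 <= c ->
  (forall l, `|y 0 l| <= c) -> `|y| <= c.
Proof.
move=> c0 h; rewrite [leLHS]/Num.norm /= mx_normrE.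
by apply/bigmax_leP; split=> [//|[i l] _ /=]; rewrite (ord1 i).
Qed.

(** * Heine-Borel for complex matrices *)

Section HeineBorel.
Variables (R : realType) (m : nat).
Local Notation C := R[i].
Local Notation D := (m * m * 2)%N.

Let pos (i j : 'I_m) (b : 'I_2) : 'I_D := mxtens_index (mxtens_index (i, j), b).

(** Real coordinates of a complex matrix. The two norm bounds below compare the sup norm of the row
    with [hsnorm], so that open sets and bounded sets carry over. *)
Let mx_of_row (y : 'rV[R]_D) : 'M[C]_m :=
  \matrix_(i, j) Complex (y 0 (pos i j 0)) (y 0 (pos i j 1)).

Let row_of_mx (X : 'M[C]_m) : 'rV[R]_D :=
  \row_l let: (ij, b) := mxtens_unindex l in let: (i, j) := mxtens_unindex ij in
  if b == 0 then Re (X i j) else Im (X i j).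

Let row_of_mxK X : mx_of_row (row_of_mx X) = X.
Proof.
by apply/matrixP=> i j; rewrite !mxE /pos !mxtens_indexK; case: (X i j).
Qed.

Let mx_of_rowB y z : mx_of_row (y - z) = mx_of_row y - mx_of_row z.
Proof. by apply/matrixP=> i j; rewrite !mxE. Qed.

Let hsnorm_mx_of_row y : hsnorm (mx_of_row y) <= (2 * m%:R) * `|y|.
Proof.
have c0 : 0 <= 2 * m%:R :> R by rewrite mulr_ge0 ?ler0n.
rewrite -ler_sqr ?nnegrE ?hsnorm_ge0 ?mulr_ge0//.
rewrite sqr_hsnorm frobAE.
apply: (@le_trans _ _ (\sum_(i < m) \sum_(j < m) 2 * `|y| ^+ 2)).
  apply: ler_sum => i _; apply: ler_sum => j _; rewrite !mxE /=.
  have sq l : y 0 l ^+ 2 <= `|y| ^+ 2.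
    by rewrite -(real_normK (num_real (y 0 l))) ler_sqr ?nnegrE// coord_le_norm.
  by have := sq (pos i j 0); have := sq (pos i j 1); lra.
rewrite !sumr_const !card_ord -[X in X *+ m]mulr_natl -[leLHS]mulr_natl.
have : 0 <= (m%:R * `|y|) ^+ 2 by exact: sqr_ge0.
by rewrite !exprMn !expr2; lra.
Qed.

Let norm_le_hsnorm y : `|y| <= hsnorm (mx_of_row y).
Proof.
apply: norm_le_coord => [|l]; first exact: hsnorm_ge0.
case: (mxtens_indexP l) => ij b; case: (mxtens_indexP ij) => i j.
apply: le_trans (normc_le_hsnorm _ i j); rewrite !mxE /=.
rewrite -[mxtens_index _]/(pos i j b) -sqrtr_sqr ler_wsqrtr//.
have [->|->] : b = 0 \/ b = 1.
  by case: b => [[|[|b]] p]//; [left|right]; exact: val_inj.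
- by rewrite lerDl sqr_ge0.
- by rewrite lerDr sqr_ge0.
Qed.

Let open_preimage U : openM U -> open (mx_of_row @^-1` U).
Proof.
move=> oU; rewrite openE => y Uy; have [e [e0 he]] := oU _ Uy.
(* The [+ 1] keeps the denominator positive when [m = 0]. *)
apply/nbhs_ballP; exists (e / (2 * m%:R + 1)) => /=.
  by rewrite divr_gt0// ltr_wpDl// mulr_ge0.
move=> z; rewrite -ball_normE /= => yz; apply: he.
rewrite /Defs.mdist -mx_of_rowB.
apply: (le_lt_trans (hsnorm_mx_of_row _)).
apply: (@le_lt_trans _ _ ((2 * m%:R + 1) * `|y - z|)).
  by rewrite ler_wpM2r// lerDl.
by rewrite mulrC -ltr_pdivlMr// ltr_wpDl// mulr_ge0.
Qed.

Lemma closed_bounded_compactM (K : set 'M[C]_m) (c : R) :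
  openM (~` K) -> (forall X, K X -> hsnorm X <= c) -> compactM K.
Proof.
move=> cK bK I U oU KU.
have : compact (mx_of_row @^-1` K).
  apply: bounded_closed_compact.
    exists c; split=> [|x cx y /= Ky]; first exact: num_real.
    exact: le_trans (norm_le_hsnorm _) (le_trans (bK _ Ky) (ltW cx)).
  by rewrite -openC preimage_setC; exact: open_preimage.
rewrite compact_cover => /(_ {classic I} setT (fun i => mx_of_row @^-1` U i)) [].
- by move=> i _; exact: open_preimage.
- by move=> y /= /KU[i Ui]; exists i.
move=> D' _ hD'; pose s := finmap.enum_fset D'.
exists (size s), (tnth (in_tuple s)) => X KX.
have [|i /= iD'] := hD' (row_of_mx X); first by rewrite /= row_of_mxK.
rewrite row_of_mxK => Ui; have /tnthP[j ij] : i \in in_tuple s by [].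
by exists j; rewrite -ij.
Qed.

End HeineBorel.

(** * Nearest points and supporting half-spaces *)

Section NearestPoint.
Variable R : realType.
Local Notation C := R[i].
Variable m : nat.
Implicit Types (K S : set 'M[C]_m).

Lemma image_compactM n (f : {linear 'M[C]_n -> 'M[C]_m}) (K : set 'M[C]_n) :
  compactM K -> compactM (f @` K).
Proof.
move=> cK I U oU KU; have [c c0 fc] := linear_bounded f.
have [|X KX|r [g hg]] := cK I (fun i => f @^-1` U i).
- move=> i X /= UX; have [e [e0 he]] := oU i _ UX.
  exists (e / (c + 1)); split=> [|Y XY]; first by rewrite divr_gt0// ltr_wpDl.
  apply: he; rewrite /Defs.mdist -linearB (le_lt_trans (fc _))//.
  apply: (@le_lt_trans _ _ ((c + 1) * mdist X Y)).
    by rewrite ler_wpM2r ?hsnorm_ge0// lerDl.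
  by rewrite mulrC -ltr_pdivlMr// ltr_wpDl.
- by apply: KU; exists X.
- by exists r, g => _ [X KX <-]; exact: hg.
Qed.

(** Without a nearest point, the open sets of points strictly farther from [Y] than a given [W] in
    [K] would cover [K]. Among the finitely many [W] of a subcover, the one closest to [Y] lies in
    none of them. *)
Lemma compactM_nearest K Y : compactM K -> K !=set0 ->
  exists2 Z, K Z & forall W, K W -> mdist Y Z <= mdist Y W.
Proof.
move=> cK [W0 KW0]; apply: contrapT => noZ.
have far Z : K Z -> exists2 W, K W & mdist Y W < mdist Y Z.
  move=> KZ; apply: contrapT => noW; apply: noZ; exists Z => // W KW.
  by rewrite leNgt; apply/negP => lt; apply: noW; exists W.
have [|X /far[W KW WX]|r [f hf]] :=
    cK {W | K W} (fun W => [set X | mdist Y (sval W) < mdist Y X]).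
- move=> W X /= WX; exists (mdist Y X - mdist Y (sval W)).
  rewrite subr_gt0; split=> // Z XZ /=.
  by have := hsdist_triangle Y Z X; rewrite (hsdistC Z); lra.
- by exists (exist _ W KW).
have [j0 _] := hf _ KW0.
have [j _ jmin] : exists2 j : 'I_r, true &
    forall i, mdist Y (sval (f j)) <= mdist Y (sval (f i)).
  by case: (arg_minP (fun j => mdist Y (sval (f j))) (i0 := j0) (P := xpredT)) =>
    // j _ h; exists j => // i; exact: h.
by have [i /=] := hf _ (svalP (f j)); rewrite ltNge jmin.
Qed.

(** First-order condition: moving from [Z] towards [W] by a fraction [t] cannot decrease the
    distance to [Y], so [2 b t <= c t^2] on [[0, 1]], which forces [b <= 0]. Thus [K] lies in a
    half-space with normal [Y - Z]. *)
Lemma nearest_obtuse K Y Z : convexM K -> K Z ->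
  (forall W, K W -> mdist Y Z <= mdist Y W) ->
  forall W, K W -> frob (Y - Z) W <= frob (Y - Z) Z.
Proof.
move=> vK KZ nZ W KW; rewrite -subr_le0 -frobBr; set b := frob _ _.
pose c := frob (W - Z) (W - Z).
have c0 : 0 <= c by exact: frob_ge0.
have H t : 0 <= t -> t <= 1 -> 2 * b * t <= c * t ^+ 2.
  move=> t0 t1; set V := t%:C%C *: W + (1 - t)%:C%C *: Z.
  have : mdist Y Z ^+ 2 <= mdist Y V ^+ 2.
    by rewrite ler_sqr ?nnegrE ?hsdist_ge0//; apply: nZ; exact: vK.
  rewrite /Defs.mdist !sqr_hsnorm {}/V.
  have -> : Y - (t%:C%C *: W + (1 - t)%:C%C *: Z) = (Y - Z) - t%:C%C *: (W - Z).
    rewrite rmorphB rmorph1 scalerBl scale1r scalerBr !opprD !opprK.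
    by rewrite !addrA; congr (_ + _); rewrite addrAC.
  have -> (u d : 'M[C]_m) : frob (u - t%:C%C *: d) (u - t%:C%C *: d) =
      frob u u - 2 * frob u d * t + frob d d * t ^+ 2.
    by rewrite frobBl !frobBr !frobZl !frobZr (frobC d u); ring.
  by rewrite -/b -/c; move: (frob (Y - Z) _) => a; clearbody b c; lra.
clearbody b c.
rewrite leNgt; apply/negP => b0.
(* This [t] lies in [(0, 1]] and satisfies [c t <= b], against [2 b <= c t]. *)
pose t := b / (b + c + 1).
have den : 0 < b + c + 1 by lra.
have t0 : 0 < t by rewrite divr_gt0.
have t1 : t <= 1 by rewrite ler_pdivrMr// mul1r; lra.
have := H t (ltW t0) t1.
rewrite expr2 (mulrA c t t) ler_pM2r// => h.
have : t * (b + c + 1) = b by rewrite divfK// gt_eqF.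
by nra.
Qed.

End NearestPoint.

(** * Positive semidefinite matrices and density matrices *)

Section Positive.
Variable R : realType.
Local Notation C := R[i].

Lemma hsnorm_adjmx m n (A : 'M[C]_(m, n)) : hsnorm (adjmx A) = hsnorm A.
Proof.
rewrite !hsnormE !frobAE exchange_big /=; congr Num.sqrt.
apply: eq_bigr => i _; apply: eq_bigr => j _; rewrite mxE.
by case: (A i j) => a b /=; rewrite sqrrN.
Qed.

Lemma normc_trace m (A : 'M[C]_m) : normc (\tr A) <= m%:R * hsnorm A.
Proof.
rewrite -[m in m%:R]card_ord mulr_natl -sumr_const /mxtrace.
elim/big_ind2: _ => [|x1 x2 y1 y2 h1 h2|i _].
- by rewrite normc0.
- by apply: (le_trans (le_normcD _ _)); rewrite lerD.
- exact: normc_le_hsnorm.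
Qed.

Lemma ge0_complexE (z : C) : (0 <= z) = (Im z == 0) && (0 <= Re z).
Proof. by rewrite lecE. Qed.

(** The form equals its own conjugate. This turns the complex order in [psd] into a real inequality
    on [frob]. *)
Lemma hermitian_form m (A : 'M[C]_m) (v : 'cV[C]_m) : hermitian A ->
  (adjmx v *m A *m v) 0 0 = (frob v (A *m v))%:C%C.
Proof.
move=> hA; have tr1 : \tr (adjmx v *m A *m v) = (adjmx v *m A *m v) 0 0.
  by rewrite /mxtrace big_ord1.
have : conjc (\tr (adjmx v *m A *m v)) = \tr (adjmx v *m A *m v).
  by rewrite -trace_adjmx !adjmxM adjmxK hA mulmxA.
rewrite /frob mulmxA tr1; case: (_ 0 0) => a b /= [/esym/eqP].
by rewrite -addr_eq0 -mulr2n mulrn_eq0 /= => /eqP->.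
Qed.

Lemma psd_form_ge0 m (A : 'M[C]_m) (v : 'cV[C]_m) : psd A -> 0 <= frob v (A *m v).
Proof. by move=> [hA /(_ v)]; rewrite hermitian_form// ler0c. Qed.

Lemma psdP m (A : 'M[C]_m) :
  hermitian A -> (forall v : 'cV[C]_m, 0 <= frob v (A *m v)) -> psd A.
Proof. by move=> hA h; split=> // v; rewrite hermitian_form// ler0c. Qed.

Lemma hermitian_dyad m (x : 'cV[C]_m) : hermitian (x *m adjmx x).
Proof. by rewrite /Defs.hermitian adjmxM adjmxK. Qed.

Lemma frob_dyad m (A : 'M[C]_m) (x : 'cV[C]_m) : frob A (x *m adjmx x) = frob (A *m x) x.
Proof. by rewrite /frob mulmxA mxtrace_mulC mulmxA adjmxM. Qed.

Lemma psd_dyad m (x : 'cV[C]_m) : psd (x *m adjmx x).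
Proof.
apply: psdP => [|v]; first exact: hermitian_dyad.
by rewrite -mulmxA frob_mulmx frob_ge0.
Qed.

Lemma trace_dyad m (x : 'cV[C]_m) : \tr (x *m adjmx x) = (frob x x)%:C%C.
Proof.
rewrite mxtrace_mulC -[adjmx x]mulmx1 /mxtrace big_ord1 hermitian_form ?mul1mx//.
exact: adjmx1.
Qed.

Lemma hsnorm_dyad m (x : 'cV[C]_m) : hsnorm (x *m adjmx x) = frob x x.
Proof.
rewrite hsnormE frob_dyad -mulmxA [adjmx x *m x]mx11_scalar.
rewrite -[adjmx x]mulmx1 hermitian_form ?mul1mx; last exact: adjmx1.
by rewrite mul_mx_scalar frobZl -expr2 sqrtr_sqr ger0_norm ?frob_ge0.
Qed.

(** Spectral theorem: the vectors are the eigenvectors scaled by the square roots of the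
    eigenvalues. It reduces statements about states to pure states. *)
Lemma psd_sum_dyads m (A : 'M[C]_m) : psd A ->
  exists x : 'I_m -> 'cV[C]_m, A = \sum_l x l *m adjmx (x l).
Proof.
move=> pA; have hA : A \is normalmx.
  apply/normalmxP; suff -> : map_mx Num.conj A^T = A by [].
  by rewrite -[in RHS]pA.1; apply/matrixP=> i j; rewrite !mxE.
have /orthomx_spectralP := hA.
have uP := spectral_unitarymx A; rewrite (invmx_unitary uP).
set P := spectralmx A; set d := spectral_diag A.
have -> : map_mx Num.conj P^T = adjmx P by apply/matrixP=> i j; rewrite !mxE.
move=> AE; have PP : P *m adjmx P = 1%:M.
  by rewrite -(unitarymxP uP); congr (_ *m _); apply/matrixP=> i j; rewrite !mxE.
(* Inverting the diagonalisation shows each eigenvalue as the value of the form of [A] at an adjoint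
   row of [P], hence nonnegative. *)
have dE : diag_mx d = P *m A *m adjmx P.
  by rewrite AE -!mulmxA PP mulmx1 mulmxA PP mul1mx.
have d0 l : d 0 l = (Num.sqrt (Re (d 0 l)))%:C%C * conjc (Num.sqrt (Re (d 0 l)))%:C%C.
  have : 0 <= d 0 l.
    have -> : d 0 l = (adjmx (adjmx (row l P)) *m A *m adjmx (row l P)) 0 0.
      rewrite adjmxK; have := congr1 (fun M : 'M[C]_m => M l l) dE.
      rewrite mxE eqxx mulr1n => ->; rewrite -row_mul !mxE; apply: eq_bigr => j _.
      by rewrite !mxE.
    exact: pA.2.
  rewrite conjc_real -rmorphM -expr2 ge0_complexE.
  by case: (d 0 l) => a b /= /andP[/eqP-> a0]; rewrite sqr_sqrtr.
exists (fun l => (Num.sqrt (Re (d 0 l)))%:C%C *: adjmx (row l P)).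
rewrite {1}AE; apply/matrixP=> i j; rewrite mul_mx_diag !mxE summxE.
apply: eq_bigr => l _; rewrite !mxE big_ord1 !mxE.
by rewrite [in LHS]d0 [conjc (_ * _)]rmorphM /= conjcK; ring.
Qed.

(** On dyads there is equality; the triangle inequality does the rest. *)
Lemma hsnorm_psd m (A : 'M[C]_m) : psd A -> hsnorm A <= Re (\tr A).
Proof.
move=> /psd_sum_dyads[x ->]; apply: (le_trans (hsnorm_sum _ _)).
rewrite Re_trace_sum; apply: ler_sum => l _.
by rewrite hsnorm_dyad trace_dyad.
Qed.

(** Cauchy-Schwarz for the semi-inner product [<v, T w>] at [w = T v] gives [||w||^4 <= <v, T v> <w,
    T w> <= s ||v||^2 s ||w||^2], and [||w||^2] cancels. *)
Lemma opnorm_psd_le m (T : 'M[C]_m) s : 0 <= s -> psd T ->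
  (forall v : 'cV[C]_m, frob v (T *m v) <= s * frob v v) -> opnorm T <= s.
Proof.
move=> s0 pT h; apply: opnorm_le => // v.
apply: le_hsnorm => //; set w := T *m v.
have CS : frob v (T *m w) ^+ 2 <= frob v (T *m v) * frob w (T *m w).
  apply: discriminant_le0 => [|t]; first exact: psd_form_ge0.
  suff <- : frob (v + t%:C%C *: w) (T *m (v + t%:C%C *: w)) =
      frob v (T *m v) + 2 * frob v (T *m w) * t + frob w (T *m w) * t ^+ 2.
    exact: psd_form_ge0.
  rewrite mulmxDr -scalemxAr frobDl !frobDr !frobZl !frobZr.
  by rewrite [frob w (T *m v)]frob_mulmx pT.1 (frobC _ v); ring.
have ww : frob v (T *m w) = frob w w by rewrite frob_mulmx pT.1.
rewrite ww in CS; have [w0|wn] := eqVneq (frob w w) 0.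
  by rewrite w0 mulr_ge0 ?sqr_ge0 ?frob_ge0.
have wp : 0 < frob w w by rewrite lt_def wn frob_ge0.
rewrite -(ler_pM2r wp) -expr2 (le_trans CS)//.
rewrite (_ : _ * frob w w = (s * frob v v) * (s * frob w w)); last by ring.
apply: ler_pM; rewrite ?psd_form_ge0 ?h//.
Qed.

Lemma density_hsnorm m (A : 'M[C]_m) : density A -> hsnorm A <= 1.
Proof. by move=> [pA tA]; have := hsnorm_psd pA; rewrite tA. Qed.

Lemma density_convexM m : convexM (@density R m).
Proof.
move=> X Y t [pX tX] [pY tY] t0 t1; split; last first.
  rewrite mxtraceD !mxtraceZ tX tY !mulr1 -[LHS]rmorphD /=.
  by rewrite addrCA subrr addr0.
apply: psdP => [|v].
  by rewrite /Defs.hermitian adjmxD !adjmxZ !conjc_real pX.1 pY.1.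
rewrite mulmxDl -!scalemxAl frobDr !frobZr.
by rewrite addr_ge0// mulr_ge0 ?psd_form_ge0 ?subr_ge0.
Qed.

Lemma closed_openMC m (K : set 'M[C]_m) :
  (forall X, (forall e : R, 0 < e -> exists2 Y, K Y & mdist X Y < e) -> K X) ->
  openM (~` K).
Proof.
move=> cK X nX; apply: contrapT => h; apply: nX; apply: cK => e e0.
apply: contrapT => noY; apply: h; exists e; split=> // Y XY KY.
by apply: noY; exists Y.
Qed.

Lemma le0_of_le_eps (x c : R) : 0 <= c -> (forall e : R, 0 < e -> x <= c * e) -> x <= 0.
Proof.
move=> c0 h; rewrite leNgt; apply/negP => x0.
have e0 : 0 < x / (2 * (c + 1)) by rewrite divr_gt0// mulr_gt0// ltr_wpDl.
have := h _ e0; have : x / (2 * (c + 1)) * (2 * (c + 1)) = x.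
  by rewrite divfK// mulf_neq0// gt_eqF// ltr_wpDl.
by nra.
Qed.

Lemma hermitian_closed m (X : 'M[C]_m) :
  (forall e : R, 0 < e -> exists2 Y, hermitian Y & mdist X Y < e) -> hermitian X.
Proof.
move=> cX; apply/eqP; rewrite -subr_eq0; apply/eqP/hsnorm_eq0/eqP.
rewrite eq_le hsnorm_ge0 andbT; apply: (@le0_of_le_eps _ 2) => // e e0.
have [Y hY XY] := cX e e0.
have -> : adjmx X - X = adjmx (X - Y) - (X - Y).
  by rewrite adjmxD adjmxN hY opprB addrA subrK.
rewrite (le_trans (hsnormD _ _))// hsnormN hsnorm_adjmx.
by move: XY; rewrite /Defs.mdist; lra.
Qed.

Lemma density_closed m (X : 'M[C]_m) :
  (forall e : R, 0 < e -> exists2 Y, density Y & mdist X Y < e) -> density X.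
Proof.
move=> cX; have hX : hermitian X.
  by apply: hermitian_closed => e /cX[Y [[hY _] _] XY]; exists Y.
split; last first.
  apply/eqP; rewrite -subr_eq0; apply/eqP/eq0_normc/eqP; rewrite eq_le.
  rewrite (_ : 0 <= _) ?andbT; last by case: (_ - _) => a b; exact: sqrtr_ge0.
  apply: (@le0_of_le_eps _ m%:R) => // e e0.
  have [Y [_ tY] XY] := cX e e0; rewrite -tY -raddfB (le_trans (normc_trace _))//.
  by rewrite ler_wpM2l// ltW.
apply: psdP => // v; rewrite -oppr_le0.
apply: (@le0_of_le_eps _ (frob v v)) => [|e e0]; first exact: frob_ge0.
have [Y [pY _] XY] := cX e e0.
have -> : X = Y + (X - Y) by rewrite addrC subrK.
rewrite mulmxDl frobDr; have := psd_form_ge0 v pY.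
suff : - frob v ((X - Y) *m v) <= frob v v * e by lra.
rewrite frobC -frob_dyad -frobNl (le_trans (frob_CS _ _))// hsnormN hsnorm_dyad mulrC.
by rewrite ler_wpM2l ?frob_ge0// ltW.
Qed.

Lemma density_compactM m : compactM (@density R m).
Proof.
apply: (@closed_bounded_compactM _ _ _ 1) => [|X]; last exact: density_hsnorm.
by apply: closed_openMC => X; exact: density_closed.
Qed.

End Positive.

(** * Hausdorff limits of convex sets *)

Section HausdorffLimit.
Variable R : realType.
Local Notation C := R[i].
Variable m : nat.
Implicit Types (S : nat -> set 'M[C]_m) (A W : 'M[C]_m).

(** The support functions of the sets form a Cauchy sequence at each direction. Matching points
    instead of comparing suprema avoids default values for empty sets. *)
Definition support_cauchy S := forall A, hermitian A -> forall eta : R, 0 < eta ->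
  exists N0, forall n l, (N0 <= n)%N -> (N0 <= l)%N ->
    forall W, S n W -> exists2 W', S l W' & frob A W <= frob A W' + eta.

(** The one-sided estimate is symmetric once it is asked for all pairs of large indices. *)
Definition hausdorff_cauchy S := forall eta : R, 0 < eta ->
  exists N0, forall n l, (N0 <= n)%N -> (N0 <= l)%N ->
    forall W, S n W -> exists2 W', S l W' & mdist W W' <= eta.

Lemma hermitian_unit_ball_compactM :
  compactM [set A : 'M[C]_m | hermitian A /\ hsnorm A <= 1].
Proof.
apply: (@closed_bounded_compactM _ _ _ 1) => [|A [_ ]//].
apply: closed_openMC => X cX; split.
  by apply: hermitian_closed => e /cX[Y [hY _] XY]; exists Y.
rewrite -subr_le0; apply: (@le0_of_le_eps _ _ 1) => // e e0.
have [Y [_ Y1] XY] := cX e e0; have := hsnormD (X - Y) Y.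
by rewrite subrK; move: XY; rewrite /Defs.mdist; lra.
Qed.

(** Density matrices have norm at most 1, so [frob A W] is 1-Lipschitz in [A]; a finite net of
    directions then gives one rank for the whole unit ball. *)
Lemma support_cauchy_uniform S : (forall n, S n `<=` @density R m) ->
  support_cauchy S -> forall eta : R, 0 < eta ->
  exists N0, forall n l, (N0 <= n)%N -> (N0 <= l)%N ->
    forall A, hermitian A -> hsnorm A <= 1 ->
    forall W, S n W -> exists2 W', S l W' & frob A W <= frob A W' + eta.
Proof.
move=> dS cS eta eta0.
(* The cover is indexed by directions paired with a rank valid for them, so a finite subcover has a
   maximal rank. The error is [eta / 4] from the net direction and [eta / 4] for each of the two
   changes of direction. *)
pose good (i : 'M[C]_m * nat) := forall n l, (i.2 <= n)%N -> (i.2 <= l)%N ->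
  forall W, S n W -> exists2 W', S l W' & frob i.1 W <= frob i.1 W' + eta / 4.
have [| |r [f hf]] := hermitian_unit_ball_compactM
    (U := fun i : {i | good i} => [set A | mdist (sval i).1 A < eta / 4]).
- move=> i A /= iA; exists (eta / 4 - mdist (sval i).1 A).
  rewrite subr_gt0; split=> // B AB.
  by have := hsdist_triangle (sval i).1 A B; rewrite /=; lra.
- move=> A [hA _]; have [N0 hN0] := cS A hA (eta / 4) (divr_gt0 eta0 (ltr0Sn _ _)).
  by exists (exist good (A, N0) hN0); rewrite /= hsdistxx divr_gt0.
exists (\max_(j < r) (sval (f j)).2)%N => n l hn hl A hA A1 W SW.
have [j /= jA] := hf A (conj hA A1).
have le_max : ((sval (f j)).2 <= \max_(j < r) (sval (f j)).2)%N by exact: leq_bigmax.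
have [W' SW' WW'] := svalP (f j) n l (leq_trans le_max hn) (leq_trans le_max hl) W SW.
exists W' => //; set A0 := (sval (f j)).1 in jA WW'.
have close V : density V -> `|frob A V - frob A0 V| <= eta / 4.
  move=> /density_hsnorm V1; rewrite -frobBl ler_norml lerNl -frobNl opprB.
  have le1 (B : 'M[C]_m) : hsnorm B <= eta / 4 -> frob B V <= eta / 4.
    move=> B1; rewrite (le_trans (frob_CS _ _))// (le_trans _ B1)//.
    by rewrite ler_piMr ?hsnorm_ge0.
  move: jA; rewrite /Defs.mdist => /ltW jA.
  by rewrite !le1// -hsnormN opprB.
have := close _ (dS _ _ SW); have := close _ (dS _ _ SW').
by rewrite !ler_norml => /andP[? ?] /andP[? ?]; lra.
Qed.

(** Let [Z] be the point of [S l] nearest to [W], and [u] the unit vector along [W - Z]. The set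
    [S l] lies below [Z] in direction [u], while some point of it is within [eta] of [W] in that
    direction, so [||W - Z|| <= eta]. *)
Lemma support_cauchy_hausdorff S :
  (forall n, compactM (S n)) -> (forall n, convexM (S n)) ->
  (forall n, S n `<=` @density R m) -> support_cauchy S -> hausdorff_cauchy S.
Proof.
move=> kS vS dS cS eta eta0.
have [N0 hN0] := support_cauchy_uniform dS cS eta0.
exists N0 => n l hn hl W SW.
have h0 : hermitian (0 : 'M[C]_m) by apply/matrixP => i j; rewrite !mxE conjc0.
(* The zero direction serves to show that [S l] is nonempty. *)
have [|V SV _] := hN0 n l hn hl 0 h0 _ W SW; first by rewrite hsnorm0.
have [Z SZ nZ] := compactM_nearest W (kS l) (ex_intro _ V SV).
exists Z => //; rewrite /Defs.mdist.
have [d0|dn] := eqVneq (hsnorm (W - Z)) 0; first by rewrite d0 ltW.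
have dp : 0 < hsnorm (W - Z) by rewrite lt_def dn hsnorm_ge0.
pose u := ((hsnorm (W - Z))^-1)%:C%C *: (W - Z).
have hu : hermitian u.
  rewrite /Defs.hermitian adjmxZ conjc_real adjmxD adjmxN.
  by rewrite (dS _ _ SW).1.1 (dS _ _ SZ).1.1.
have u1 : hsnorm u <= 1.
  by rewrite hsnormZr ger0_norm ?invr_ge0 ?hsnorm_ge0// mulVf.
have [X SX] := hN0 n l hn hl u hu u1 W SW.
have := nearest_obtuse (vS l) SZ nZ SX.
rewrite -(ler_pM2l (x := (hsnorm (W - Z))^-1)) ?invr_gt0// -!frobZl -/u => XZ WX.
have : frob u (W - Z) = hsnorm (W - Z).
  by rewrite frobZl -sqr_hsnorm expr2 mulKf.
by rewrite frobBr => <-; lra.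
Qed.

(** [K] collects the points every neighbourhood of which meets all [S n] from some rank on;
    closedness, convexity and inclusion in the density matrices pass to this limit. *)
Lemma hausdorff_cauchy_limit S :
  (forall n, compactM (S n)) -> (forall n, convexM (S n)) ->
  (forall n, S n `<=` @density R m) -> hausdorff_cauchy S ->
  exists K : set 'M[C]_m,
    [/\ compactM K, convexM K, K `<=` @density R m &
     [/\ relint K `<=` set_liminf S, set_liminf S `<=` set_limsup S &
      set_limsup S `<=` K]].
Proof.
move=> kS vS dS cS.
pose K : set 'M[C]_m := [set X | forall e : R, 0 < e ->
  exists N0, forall n, (N0 <= n)%N -> exists2 W, S n W & mdist X W <= e].
have Kcl X : (forall e : R, 0 < e -> exists2 Y, K Y & mdist X Y < e) -> K X.
  move=> cX e e0; have [Y KY XY] := cX (e / 2) (divr_gt0 e0 (ltr0Sn _ _)).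
  have [N0 hN0] := KY (e / 2) (divr_gt0 e0 (ltr0Sn _ _)).
  exists N0 => n /hN0[W SW YW]; exists W => //.
  by have := hsdist_triangle X Y W; lra.
have KD : K `<=` @density R m.
  move=> X KX; apply: density_closed => e e0.
  have [N0 hN0] := KX (e / 2) (divr_gt0 e0 (ltr0Sn _ _)).
  have [W SW XW] := hN0 N0 (leqnn _); exists W; first exact: (dS N0).
  by lra.
(* The rank is uniform in [X]: the point is approached at a late index depending on it, and the
   Cauchy property carries the approximation to every [n] past [N0]. *)
have KS eta : 0 < eta -> exists N0, forall n, (N0 <= n)%N ->
    forall X, K X -> exists2 W, S n W & mdist X W <= eta.
  move=> eta0; have e20 : 0 < eta / 2 by rewrite divr_gt0.
  have [N0 hN0] := cS _ e20; exists N0 => n hn X KX.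
  have [N1 hN1] := KX _ e20.
  have [W SW XW] := hN1 (maxn N0 N1) (leq_maxr _ _).
  have [W' SW' WW'] := hN0 _ _ (leq_maxl N0 N1) hn W SW.
  by exists W' => //; have := hsdist_triangle X W W'; lra.
exists K; split=> //.
- apply: (@closed_bounded_compactM _ _ _ 1) => [|X KX]; first exact: closed_openMC.
  exact/density_hsnorm/KD.
- move=> X Y t KX KY t0 t1 e e0.
  have [N0 hN0] := KX e e0; have [N1 hN1] := KY e e0.
  exists (maxn N0 N1) => n; rewrite geq_max => /andP[/hN0[V SV XV] /hN1[W SW YW]].
  exists (t%:C%C *: V + (1 - t)%:C%C *: W); first exact: vS.
  rewrite /Defs.mdist opprD addrACA -!scalerBr (le_trans (hsnormD _ _))//.
  rewrite !hsnormZr !ger0_norm ?subr_ge0//.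
  have := ler_wpM2l t0 XV; have t10 : 0 <= 1 - t by rewrite subr_ge0.
  by have := ler_wpM2l t10 YW; rewrite /Defs.mdist; lra.
split.
- move=> Y [[hY tY] [e [e0 he]]].
  (* The push below has length [e / 2], so the pushed point is at distance at least [e / 2] from
     [S n]; being in [K], it should be within [e / 4]. *)
  have e40 : 0 < e / 4 by rewrite divr_gt0.
  have [N0 hN0] := KS _ e40.
  exists N0 => n hn; apply: contrapT => nY.
  have KY : K Y by apply: he => //; rewrite hsdistxx.
  have [W SW _] := hN0 n hn Y KY.
  have [Z SZ nZ] := compactM_nearest Y (kS n) (ex_intro _ W SW).
  have dn : hsnorm (Y - Z) != 0.
    by apply/eqP => /hsnorm_eq0/eqP; rewrite subr_eq0 => /eqP YZ; apply: nY; rewrite YZ.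
  have dp : 0 < hsnorm (Y - Z) by rewrite lt_def dn hsnorm_ge0.
  (* pushing Y away from its nearest point of S n stays in K but leaves S n behind *)
  pose u := ((hsnorm (Y - Z))^-1)%:C%C *: (Y - Z).
  have u1 : hsnorm u = 1.
    by rewrite hsnormZr ger0_norm ?invr_ge0 ?hsnorm_ge0// mulVf.
  have [[hZ _] tZ] := dS _ _ SZ.
  have tu : \tr u = 0 by rewrite mxtraceZ raddfB /= tY tZ subrr mulr0.
  have hu : hermitian u.
    by rewrite /Defs.hermitian adjmxZ conjc_real adjmxD adjmxN hY hZ.
  pose Y' := Y + (e / 2)%:C%C *: u.
  have /(hN0 n hn)[X SX Y'X] : K Y'.
    apply: he; first split.
    + by rewrite /Defs.hermitian adjmxD adjmxZ conjc_real hY hu.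
    + by rewrite mxtraceD mxtraceZ tY tu mulr0 addr0.
    + rewrite hsdistC /Defs.mdist /Y' addrAC subrr add0r hsnormZr u1 mulr1.
      by rewrite ger0_norm; lra.
  have := nearest_obtuse (vS n) SZ nZ SX.
  rewrite -(ler_pM2l (x := (hsnorm (Y - Z))^-1)) ?invr_gt0// -!frobZl -/u => XZ.
  have uYZ : frob u (Y - Z) = hsnorm (Y - Z).
    by rewrite frobZl -sqr_hsnorm expr2 mulKf.
  have := frob_CS u (Y' - X); rewrite u1 mul1r.
  have -> : frob u (Y' - X) = frob u Y + e / 2 - frob u X.
    by rewrite frobBr frobDr frobZr -(sqr_hsnorm u) u1 expr1n mulr1.
  by move: Y'X uYZ; rewrite frobBr /Defs.mdist; lra.
- move=> X [N0 hN0] N1; exists (maxn N0 N1); split; first exact: leq_maxr.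
  by apply: hN0; exact: leq_maxl.
- move=> X hX e e0; have [N0 hN0] := cS e e0.
  have [n [hn SX]] := hX N0; exists N0 => l hl.
  exact: (hN0 n l hn hl X SX).
Qed.

End HausdorffLimit.

(** * Block matrices and convergence of their norms *)

Lemma big_mxtens (M : nmodType) p d (F : 'I_(p * d) -> M) :
  \sum_i F i = \sum_a \sum_c F (mxtens_index (a, c)).
Proof.
rewrite pair_big /= (reindex (@mxtens_index p d)) /=; last first.
  by exists (@mxtens_unindex p d) => ? _; [exact: mxtens_indexK | exact: mxtens_unindexK].
by apply: eq_bigr => -[].
Qed.

Lemma sum_le_diag (R : realFieldType) p (q : 'I_p -> 'I_p -> R) :
  (forall a b, 2 * q a b <= q a a + q b b) ->
  \sum_a \sum_b q a b <= p%:R * \sum_a q a a.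
Proof.
move=> h; set s := \sum_a q a a.
apply: (@le_trans _ _ (\sum_a (p%:R * q a a + s) / 2)).
  apply: ler_sum => a _; rewrite ler_pdivlMr// mulrC mulr_sumr.
  have -> : p%:R * q a a + s = \sum_b (q a a + q b b).
    by rewrite big_split /= sumr_const card_ord mulr_natl.
  by apply: ler_sum => b _; exact: h.
rewrite -mulr_suml big_split /= -mulr_sumr -/s sumr_const card_ord -[s *+ p]mulr_natl.
by rewrite ler_pdivrMr//; lra.
Qed.

Section Blocks.
Variable R : realType.
Local Notation C := R[i].
Variables p d : nat.
Implicit Types (X Y S : 'M[C]_(p * d)) (v x : 'cV[C]_(p * d)) (w : 'cV[C]_d).

Definition block_mx_of (F : 'I_p -> 'I_p -> 'M[C]_d) : 'M[C]_(p * d) :=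
  \matrix_(i, j) F (mxtens_unindex i).1 (mxtens_unindex j).1
                   (mxtens_unindex i).2 (mxtens_unindex j).2.

Definition block_cV v a : 'cV[C]_d := \col_c v (mxtens_index (a, c)) 0.

Definition inj_cV a w : 'cV[C]_(p * d) :=
  \col_i if (mxtens_unindex i).1 == a then w (mxtens_unindex i).2 0 else 0.

Lemma block_mx_ofK F a b : mxblock (block_mx_of F) a b = F a b.
Proof. by apply/matrixP=> c e; rewrite !mxE !mxtens_indexK. Qed.

Lemma mxblock_mulmx X Y a b :
  mxblock (X *m Y) a b = \sum_c mxblock X a c *m mxblock Y c b.
Proof.
apply/matrixP=> i j; rewrite !mxE big_mxtens summxE; apply: eq_bigr => c _.
by rewrite !mxE; apply: eq_bigr => e _; rewrite !mxE.
Qed.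

Lemma block_inj_cV a b w : block_cV (inj_cV a w) b = if b == a then w else 0.
Proof.
by apply/matrixP=> i j; rewrite !mxE mxtens_indexK /=; case: eqP; rewrite ?mxE ?ord1.
Qed.

Lemma block_mulmx_cV S v a : block_cV (S *m v) a = \sum_b mxblock S a b *m block_cV v b.
Proof.
apply/matrixP=> i j; rewrite !mxE big_mxtens summxE; apply: eq_bigr => c _.
by rewrite !mxE; apply: eq_bigr => e _; rewrite !mxE.
Qed.

Lemma cV_sum_inj v : v = \sum_a inj_cV a (block_cV v a).
Proof.
apply/matrixP=> i j; case: (mxtens_indexP i) => a c.
rewrite summxE (bigD1 a) //= big1 => [|b ba]; rewrite !mxE mxtens_indexK /=.
  by rewrite eqxx addr0 (ord1 j).
by rewrite eq_sym (negbTE ba).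
Qed.

Lemma frob_blocks v x : frob v x = \sum_a frob (block_cV v a) (block_cV x a).
Proof.
rewrite /frob -Re_sum /mxtrace !big_ord1 mxE big_mxtens; congr Re.
apply: eq_bigr => a _; rewrite big_ord1 mxE; apply: eq_bigr => c _.
by rewrite !mxE.
Qed.

Lemma frob_inj_cV a w v : frob (inj_cV a w) v = frob w (block_cV v a).
Proof.
rewrite frob_blocks (bigD1 a)//= big1 => [|b ba]; rewrite block_inj_cV.
  by rewrite eqxx addr0.
by rewrite (negbTE ba) frobC /frob mulmx0 raddf0.
Qed.

Lemma form_inj_cV S a w : frob (inj_cV a w) (S *m inj_cV a w) = frob w (mxblock S a a *m w).
Proof.
rewrite frob_inj_cV block_mulmx_cV (bigD1 a)//= big1 ?block_inj_cV ?eqxx ?addr0//.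
by move=> b ba; rewrite block_inj_cV (negbTE ba) mulmx0.
Qed.

Lemma hsnorm_inj_cV a w : hsnorm (inj_cV a w) = hsnorm w.
Proof. by rewrite !hsnormE frob_inj_cV block_inj_cV eqxx. Qed.

Lemma hsnorm_block_cV v a : hsnorm (block_cV v a) <= hsnorm v.
Proof.
rewrite !hsnormE ler_wsqrtr// [leRHS]frob_blocks (bigD1 a)//= lerDl.
by apply: sumr_ge0 => b _; exact: frob_ge0.
Qed.

(** Positivity at [x a - x b] bounds each cross term by the mean of two diagonal terms. *)
Lemma form_sum_le n (S : 'M[C]_n) (x : 'I_p -> 'cV[C]_n) : psd S ->
  frob (\sum_a x a) (S *m \sum_a x a) <= p%:R * \sum_a frob (x a) (S *m x a).
Proof.
move=> pS; pose q a b := frob (x a) (S *m x b).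
have sum_l I (s : seq I) (F : I -> 'cV[C]_n) y :
    frob (\sum_(i <- s) F i) y = \sum_(i <- s) frob (F i) y.
  by apply: (big_morph (fun z => frob z y)) => [u v|]; rewrite ?frobDl// frobC /frob mulmx0 raddf0.
have -> : frob (\sum_a x a) (S *m \sum_a x a) = \sum_a \sum_b q a b.
  rewrite sum_l; apply: eq_bigr => a _; rewrite mulmx_sumr frobC sum_l.
  by apply: eq_bigr => b _; rewrite frobC.
have qC a b : q a b = q b a by rewrite /q frob_mulmx pS.1 frobC.
have h a b : 0 <= q a a - q a b - (q b a - q b b).
  by have := psd_form_ge0 (x a - x b) pS; rewrite mulmxBr frobBl !frobBr.
apply: (@sum_le_diag _ _ q) => a b; have := h a b; rewrite (qC b a).
by move: (q a a) (q a b) (q b b) => qaa qab qbb; lra.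
Qed.

(** Partial trace over the first tensor factor. For a matrix of polynomials it is the value of a
    single polynomial. *)
Definition block_trace S : 'M[C]_d := \sum_a mxblock S a a.

Lemma psd_mxblock S a : psd S -> psd (mxblock S a a).
Proof.
move=> pS; apply: psdP => [|w]; last by rewrite -form_inj_cV; exact: psd_form_ge0.
by apply/matrixP=> i j; rewrite !mxE -[in RHS]pS.1 mxE.
Qed.

(** The form of [S] is at most [p] times the sum of its diagonal forms, and each diagonal block is
    below the partial trace because the other diagonal blocks are positive. *)
Lemma opnorm_le_block_trace S : psd S -> opnorm S <= p%:R * opnorm (block_trace S).
Proof.
move=> pS; apply: opnorm_psd_le => // [|v]; first by rewrite mulr_ge0 ?opnorm_ge0.
rewrite {1 2}[v]cV_sum_inj (le_trans (form_sum_le _ pS))// -mulrA ler_wpM2l//.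
rewrite frob_blocks mulr_sumr; apply: ler_sum => a _; rewrite form_inj_cV.
set w := block_cV v a.
apply: (@le_trans _ _ (frob w (block_trace S *m w))).
  rewrite /block_trace (bigD1 a)//= mulmxDl frobDr lerDl mulmx_suml.
  elim/big_rec: _ => [|b y _ h]; first by rewrite /frob mulmx0 raddf0.
  by rewrite frobDr addr_ge0// psd_form_ge0//; exact: psd_mxblock.
rewrite (le_trans (frob_CS _ _))// -sqr_hsnorm expr2 mulrC mulrA.
by rewrite ler_wpM2r ?hsnorm_ge0 ?opnorm_bound.
Qed.

Lemma opnorm_block_trace_le S : opnorm (block_trace S) <= p%:R * opnorm S.
Proof.
apply: opnorm_le => [|w]; first by rewrite mulr_ge0 ?opnorm_ge0.
rewrite /block_trace mulmx_suml (le_trans (hsnorm_sum _ _))//.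
rewrite -[p in p%:R]card_ord -mulrA mulr_natl -sumr_const; apply: ler_sum => a _.
have -> : mxblock S a a *m w = block_cV (S *m inj_cV a w) a.
  rewrite block_mulmx_cV (bigD1 a)//= big1 ?block_inj_cV ?eqxx ?addr0//.
  by move=> b ba; rewrite block_inj_cV (negbTE ba) mulmx0.
rewrite (le_trans (hsnorm_block_cV _ _))// (le_trans (opnorm_bound _ _))//.
by rewrite hsnorm_inj_cV.
Qed.

End Blocks.

(** * Removing a constant factor by taking roots *)

Section PowerTrick.
Variable R : realType.

Lemma exists_pow2_ge (x y : R) : 0 < x -> exists i : nat, y <= (1 + x) ^+ (2 ^ i).
Proof.
move=> x0; have [i hi] : exists i : nat, y <= i%:R * x.
  exists (Num.bound `|y / x|); rewrite -ler_pdivrMr//.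
  exact: le_trans (ler_norm _) (ltW (archi_boundP (normr_ge0 _))).
exists i; apply: (le_trans hi).
have bernoulli j : 1 + j%:R * x <= (1 + x) ^+ j.
  elim: j => [|j IH]; first by rewrite mul0r addr0 expr0.
  rewrite exprS; apply: (@le_trans _ _ ((1 + x) * (1 + j%:R * x))).
    have : 0 <= j%:R * x ^+ 2 by rewrite mulr_ge0 ?sqr_ge0.
    by rewrite expr2 -natr1; lra.
  by rewrite ler_wpM2l// addr_ge0// ltW.
apply: le_trans (bernoulli _); have : i%:R * x <= (2 ^ i)%:R * x.
  by apply: ler_wpM2r; [exact: ltW | rewrite ler_nat ltnW// ltn_expl].
by lra.
Qed.

(* If u^(2^i) agrees with a convergent sequence up to a factor c that does not
   depend on i, then taking 2^i-th roots makes the factor disappear. *)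
Lemma cauchy_of_pow2_equiv (c : R) (u : nat -> R) (e : nat -> nat -> R) : 0 < c ->
  (forall n, 0 <= u n) ->
  (forall i n, u n ^+ (2 ^ i) <= c * e i n) ->
  (forall i n, e i n <= c * u n ^+ (2 ^ i)) ->
  (forall i, exists L : R, e i @ \oo --> L) ->
  forall eta : R, 0 < eta -> exists N0, forall n l, (N0 <= n)%N -> (N0 <= l)%N ->
    u n <= u l + eta.
Proof.
move=> c0 u0 ue eu cv eta eta0.
have near_lim i (del : R) : 0 < del -> exists L N0, forall n, (N0 <= n)%N -> `|e i n - L| < del.
  move=> d0; have [L cL] := cv i; exists L.
  move/cvgrPdist_lt: cL => /(_ _ d0)[N0 _ hN0]; exists N0 => n /hN0 /=.
  by rewrite distrC.
have [L0 [N1 hN1]] := near_lim 0%N 1 ltr01.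
(* A bound for [u] past [N1], from the case [i = 0] where the power is [u] itself. *)
pose M := c * (`|L0| + 1).
have M0 : 0 < M by rewrite mulr_gt0// ltr_wpDl.
have uM n : (N1 <= n)%N -> u n <= M.
  move=> /hN1; rewrite ltr_norml => /andP[_ h].
  have := ue 0%N n; rewrite expn0 expr1 => /le_trans; apply.
  by rewrite ler_pM2l//; have := ler_norm L0; lra.
(* Since [u l <= M], adding [eta] multiplies [u l] by at least [1 + eta / M]; the power [J] turns
   this gain into at least [2 c^2]. *)
have [i hi] := exists_pow2_ge (2 * c ^+ 2) (divr_gt0 eta0 M0).
set J := (2 ^ i)%N in hi; have J0 : (0 < J)%N by rewrite expn_gt0.
have etaJ : 0 < eta ^+ J by rewrite exprn_gt0.
have del0 : 0 < eta ^+ J / (8 * c) by rewrite divr_gt0// mulr_gt0.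
have [L [N2 hN2]] := near_lim i _ del0.
exists (maxn N1 N2) => n l; rewrite !geq_max => /andP[n1 n2] /andP[l1 l2].
rewrite leNgt; apply/negP => lt.
have ul0 := u0 l.
have P1 : (u l + eta) ^+ J < u n ^+ J.
  by rewrite ltr_pXn2r// nnegrE ?u0// addr_ge0// ltW.
have P2 : eta ^+ J <= (u l + eta) ^+ J.
  by rewrite ler_pXn2r ?nnegrE ?lerDr// ?addr_ge0// ltW.
have P3 : 2 * c ^+ 2 * u l ^+ J <= (u l + eta) ^+ J.
  apply: (@le_trans _ _ (((1 + eta / M) * u l) ^+ J)).
    by rewrite exprMn ler_wpM2r// exprn_ge0.
  have h0 : 0 <= (1 + eta / M) * u l.
    by rewrite mulr_ge0// addr_ge0// divr_ge0// ltW.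
  rewrite ler_pXn2r ?nnegrE ?(addr_ge0 ul0 (ltW eta0))//.
  rewrite mulrDl mul1r lerD2l mulrAC ler_pdivrMr// ler_pM2l//.
  exact: uM.
have := hN2 n n2; have := hN2 l l2; rewrite !ltr_norml => /andP[? ?] /andP[? ?].
have en : e i n <= e i l + eta ^+ J / (4 * c).
  have -> : eta ^+ J / (4 * c) = 2 * (eta ^+ J / (8 * c)) by field; rewrite gt_eqF.
  by lra.
(* By [P3] and [P2] the right side is at most [3/4] of [(u l + eta)^J], which contradicts [P1]. *)
have P4 : u n ^+ J <= c ^+ 2 * u l ^+ J + eta ^+ J / 4.
  apply: (le_trans (ue i n)).
  have -> : eta ^+ J / 4 = c * (eta ^+ J / (4 * c)) by field; rewrite gt_eqF.
  have -> : c ^+ 2 * u l ^+ J + c * (eta ^+ J / (4 * c)) =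
    c * (c * u l ^+ J + eta ^+ J / (4 * c)) by ring.
  rewrite ler_pM2l//; apply: (le_trans en); rewrite lerD2r.
  exact: eu.
by lra.
Qed.

End PowerTrick.

(** * Matrices over the non-commutative polynomials *)

Section MatrixCoefficients.
Variable R : realType.
Local Notation C := R[i].
Variable V : Type.

Definition ncsum (s : seq (ncpoly C V)) : ncpoly C V := foldr NCAdd (NCConst 0) s.

Lemma nceval_ncsum d (x : V -> 'M[C]_d) I (s : seq I) (F : I -> ncpoly C V) :
  nceval x (ncsum [seq F i | i <- s]) = \sum_(i <- s) nceval x (F i).
Proof.
elim: s => [|i s IH] /=; last by rewrite big_cons IH.
by rewrite big_nil; apply/matrixP=> i j; rewrite !mxE mul0rn.
Qed.

Definition ncmx_sqr p (F : 'I_p -> 'I_p -> ncpoly C V) a b :=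
  ncsum [seq NCMul (F a c) (F c b) | c <- enum 'I_p].

Definition nceval_mx p d (x : V -> 'M[C]_d) (F : 'I_p -> 'I_p -> ncpoly C V) :
  'M[C]_(p * d) := block_mx_of (fun a b => nceval x (F a b)).

Lemma nceval_mx_sqr p d (x : V -> 'M[C]_d) (F : 'I_p -> 'I_p -> ncpoly C V) :
  nceval_mx x (ncmx_sqr F) = nceval_mx x F *m nceval_mx x F.
Proof.
apply/matrixP=> i j; case: (mxtens_indexP i) => a c; case: (mxtens_indexP j) => b e.
have /matrixP/(_ c e) : mxblock (nceval_mx x (ncmx_sqr F)) a b =
    mxblock (nceval_mx x F *m nceval_mx x F) a b.
  rewrite mxblock_mulmx !block_mx_ofK nceval_ncsum big_enum /=.
  by apply: eq_bigr => f _; rewrite !block_mx_ofK.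
by rewrite [in X in X -> _]mxE [X in _ = X -> _]mxE.
Qed.

Lemma psd_sqr m (T : 'M[C]_m) : psd T -> psd (T *m T).
Proof.
move=> pT; apply: psdP => [|v]; first by rewrite /Defs.hermitian adjmxM pT.1.
by rewrite -mulmxA frob_mulmx pT.1 frob_ge0.
Qed.

(* Strong convergence is only used through the convergence of the norms; the
   power trick replaces the usual appeal to uniqueness of the C*-norm on M_p(A). *)
Lemma strong_conv_block_norm p (d : nat -> nat) (x : forall n, V -> 'M[C]_(d n))
    (F : 'I_p -> 'I_p -> ncpoly C V) :
  strong_conv x -> (forall n, psd (nceval_mx (x n) F)) ->
  forall eta : R, 0 < eta -> exists N0, forall n l, (N0 <= n)%N -> (N0 <= l)%N ->
    opnorm (nceval_mx (x n) F) <= opnorm (nceval_mx (x l) F) + eta.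
Proof.
move=> [mu [_ cv]] pF.
(* [G i] is the formal power of order [2^i]; its partial trace is again a polynomial, so strong
   convergence applies to it. *)
pose G i := iter i (@ncmx_sqr p) F.
have GE i n : psd (nceval_mx (x n) (G i)) /\
    opnorm (nceval_mx (x n) (G i)) = opnorm (nceval_mx (x n) F) ^+ (2 ^ i).
  elim: i => [|i [pG nG]]; first by rewrite expn0 expr1.
  rewrite /G iterS -/(G i) nceval_mx_sqr; split; first exact: psd_sqr.
  by rewrite (opnorm_sqr pG.1) nG -exprM -expnSr.
pose e i n := opnorm (nceval (x n) (ncsum [seq G i a a | a <- enum 'I_p])).
have eE i n : e i n = opnorm (block_trace (nceval_mx (x n) (G i))).
  rewrite /e nceval_ncsum big_enum /=; congr opnorm.
  by apply: eq_bigr => a _; rewrite block_mx_ofK.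
(* The factor [p.+1] instead of [p] is positive also for [p = 0]. *)
apply: (@cauchy_of_pow2_equiv _ (p.+1)%:R _ e) => //.
- by move=> n; exact: opnorm_ge0.
- move=> i n; have [pG <-] := GE i n; rewrite eE.
  by rewrite (le_trans (opnorm_le_block_trace pG))// ler_wpM2r ?opnorm_ge0// ler_nat.
- move=> i n; have [_ <-] := GE i n; rewrite eE.
  by rewrite (le_trans (opnorm_block_trace_le _))// ler_wpM2r ?opnorm_ge0// ler_nat.
- by move=> i; have [L [_ cL]] := cv (ncsum [seq G i a a | a <- enum 'I_p]); exists L.
Qed.

End MatrixCoefficients.

(** * Tensor products of channels *)

Section TensorMaps.
Variable R : realType.
Local Notation C := R[i].

Lemma matrix_tensP m n r s (A B : 'M[C]_(m * n, r * s)) :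
  (forall i j l t, A (mxtens_index (i, j)) (mxtens_index (l, t)) =
                   B (mxtens_index (i, j)) (mxtens_index (l, t))) -> A = B.
Proof.
move=> h; apply/matrixP=> x y.
by case: (mxtens_indexP x) => i j; case: (mxtens_indexP y) => l t.
Qed.

Lemma mxblock_entry p d (X : 'M[C]_(p * d)) a b i j :
  X (mxtens_index (a, i)) (mxtens_index (b, j)) = mxblock X a b i j.
Proof. by rewrite mxE. Qed.

Lemma hermitian_blocksP p d (X : 'M[C]_(p * d)) :
  hermitian X <-> forall a b, adjmx (mxblock X a b) = mxblock X b a.
Proof.
split=> [hX a b|h]; first by apply/matrixP=> i j; rewrite !mxE -[in RHS]hX mxE.
by apply: matrix_tensP => a i b j; rewrite !mxblock_entry -h !mxE.
Qed.

Definition cat_cV p d (f : 'I_p -> 'cV[C]_d) : 'cV[C]_(p * d) :=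
  \col_i f (mxtens_unindex i).1 (mxtens_unindex i).2 0.

Lemma block_cat_cV p d (f : 'I_p -> 'cV[C]_d) a : block_cV (cat_cV f) a = f a.
Proof. by apply/matrixP=> i j; rewrite !mxE mxtens_indexK (ord1 j). Qed.

Lemma mxblock_dyad p d (w : 'cV[C]_(p * d)) a b :
  mxblock (w *m adjmx w) a b = block_cV w a *m adjmx (block_cV w b).
Proof. by apply/matrixP=> i j; rewrite !mxE !big_ord1 !mxE. Qed.

Definition kraus_blocks p m n (M : 'M[C]_(m, n)) (X : 'M[C]_(p * n)) : 'M[C]_(p * m) :=
  block_mx_of (fun a b => M *m mxblock X a b *m adjmx M).

Lemma psd_kraus_blocks p m n (M : 'M[C]_(m, n)) (X : 'M[C]_(p * n)) :
  psd X -> psd (kraus_blocks M X).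
Proof.
move=> pX; apply: psdP => [|v].
  apply/hermitian_blocksP => a b; rewrite !block_mx_ofK !adjmxM adjmxK mulmxA.
  by have /hermitian_blocksP-> := pX.1.
pose w := cat_cV (fun a => adjmx M *m block_cV v a).
suff -> : frob v (kraus_blocks M X *m v) = frob w (X *m w) by exact: psd_form_ge0.
rewrite !frob_blocks; apply: eq_bigr => a _.
rewrite block_cat_cV -frob_mulmx !block_mulmx_cV mulmx_sumr; congr frob.
by apply: eq_bigr => b _; rewrite block_mx_ofK block_cat_cV !mulmxA.
Qed.

Lemma psd_sum I (s : seq I) m (F : I -> 'M[C]_m) :
  (forall i, psd (F i)) -> psd (\sum_(i <- s) F i).
Proof.
move=> pF; elim/big_rec: _ => [|i X _ pX].
  apply: psdP => [|v]; first by apply/matrixP=> i j; rewrite !mxE conjc0.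
  by rewrite mul0mx /frob mulmx0 raddf0.
apply: psdP => [|v]; first by rewrite /Defs.hermitian adjmxD (pF i).1 pX.1.
by rewrite mulmxDl frobDr addr_ge0// psd_form_ge0.
Qed.

(** Exchange of the tensor factors. [completely_positive] lets the map act on the right factor,
    whereas [Xi] acts on the left one. *)
Definition swap_tens p k (Y : 'M[C]_(p * k)) : 'M[C]_(k * p) :=
  \matrix_(x, y) Y (mxtens_index ((mxtens_unindex x).2, (mxtens_unindex x).1))
                   (mxtens_index ((mxtens_unindex y).2, (mxtens_unindex y).1)).

Lemma psd_swap_tens p k (Y : 'M[C]_(p * k)) : psd Y -> psd (swap_tens Y).
Proof.
move=> pY; apply: psdP => [|v].
  by apply/matrixP=> x y; rewrite !mxE -[in RHS]pY.1 mxE.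
pose w := cat_cV (fun a => \col_i v (mxtens_index (i, a)) 0).
suff -> : frob v (swap_tens Y *m v) = frob w (Y *m w) by exact: psd_form_ge0.
rewrite /frob /mxtrace !big_ord1 !mxE !big_mxtens exchange_big /=; congr Re.
apply: eq_bigr => a _; apply: eq_bigr => i _; rewrite !mxE !mxtens_indexK /=; congr (_ * _).
rewrite !big_mxtens exchange_big /=; apply: eq_bigr => b _; apply: eq_bigr => j _.
by rewrite !mxE !mxtens_indexK.
Qed.

Lemma tmap_idE m p q (f : 'M[C]_p -> 'M[C]_q) (X : 'M[C]_(m * p)) a b :
  mxblock (tmap id f X) a b = f (mxblock X a b).
Proof.
apply/matrixP=> i j; rewrite mxE summxE (bigD1 a)//= summxE (bigD1 b)//=.
rewrite tensmxE mxE !eqxx mul1r big1 ?addr0 => [|c cb]; last first.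
  by rewrite tensmxE mxE eqxx eq_sym (negbTE cb) mul0r.
rewrite big1 ?addr0// => c ca; rewrite summxE big1// => e _.
by rewrite tensmxE mxE eq_sym (negbTE ca) mul0r.
Qed.

(* f (E_ab) is the (a, b) block of the Choi matrix of f, which is Hermitian. *)
Lemma cp_adjmx_delta p q (f : 'M[C]_p -> 'M[C]_q) a b : completely_positive f ->
  adjmx (f (delta_mx a b)) = f (delta_mx b a).
Proof.
move=> cp; pose w := cat_cV (fun a => delta_mx a 0 : 'cV[C]_p).
have blk c e : mxblock (w *m adjmx w) c e = delta_mx c e.
  rewrite mxblock_dyad !block_cat_cV; apply/matrixP=> i j.
  by rewrite !mxE big_ord1 !mxE !eqxx !andbT rmorph_nat -natrM mulnb.
have /hermitian_blocksP/(_ a b) := (cp _ _ (psd_dyad w)).1.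
by rewrite !tmap_idE !blk.
Qed.

(** These are the Kraus operators of [Psi V]. *)
Definition slice_mx k n N (V : 'M[C]_(k * n, N)) (l : 'I_n) : 'M[C]_(k, N) :=
  \matrix_(i, c) V (mxtens_index (i, l)) c.

Lemma Psi_kraus k n N (V : 'M[C]_(k * n, N)) X :
  Psi V X = \sum_l slice_mx V l *m X *m adjmx (slice_mx V l).
Proof.
apply/matrixP=> i j; rewrite mxE summxE; apply: eq_bigr => l _.
rewrite !mxE; apply: eq_bigr => c _; rewrite !mxE; congr (_ * _).
by apply: eq_bigr => e _; rewrite !mxE.
Qed.

Lemma trace_ptrace2 k n (B : 'M[C]_k) (Z : 'M[C]_(k * n)) :
  \tr (B *m ptrace2 Z) = \tr ((B *t (1%:M : 'M[C]_n)) *m Z).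
Proof.
rewrite /mxtrace big_mxtens; apply: eq_bigr => i _; rewrite mxE.
under eq_bigr do rewrite mxE mulr_sumr.
rewrite exchange_big /=; apply: eq_bigr => l _; rewrite mxE big_mxtens.
apply: eq_bigr => j _; rewrite (bigD1 l)//= tensmxE mxE eqxx mulr1 big1 ?addr0// => e el.
by rewrite tensmxE mxE eq_sym (negbTE el) mulr0 mul0r.
Qed.

(** This is [(Tr_q (x) id)(A (X (x) 1))]: it turns testing [X (x) Y] against [A] into testing [Y]
    alone. *)
Definition contract_mx q k (A : 'M[C]_(q * k)) (X : 'M[C]_q) : 'M[C]_k :=
  \matrix_(j, i) \sum_t \sum_s
    A (mxtens_index (t, j)) (mxtens_index (s, i)) * X s t.

Lemma trace_contract_mx q k (A : 'M[C]_(q * k)) (X : 'M[C]_q) (Y : 'M[C]_k) :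
  \tr (contract_mx A X *m Y) = \tr (A *m (X *t Y)).
Proof.
rewrite /mxtrace big_mxtens exchange_big /=; apply: eq_bigr => j _.
under [RHS]eq_bigr do rewrite mxE big_mxtens exchange_big /=.
rewrite mxE exchange_big /=; apply: eq_bigr => i _; rewrite mxE mulr_suml.
apply: eq_bigr => t _; rewrite mulr_suml; apply: eq_bigr => s _.
by rewrite tensmxE mulrA.
Qed.

Lemma adjmx_contract_mx q k (A : 'M[C]_(q * k)) (X : 'M[C]_q) : hermitian A ->
  adjmx (contract_mx A X) = contract_mx A (adjmx X).
Proof.
move=> hA; apply/matrixP=> i j; rewrite !mxE rmorph_sum exchange_big /=.
apply: eq_bigr => t _; rewrite rmorph_sum; apply: eq_bigr => s _.
by rewrite rmorphM -[in RHS]hA !mxE.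
Qed.

End TensorMaps.

(** * The tensor product channel *)

Section OutputMap.
Variable R : realType.
Local Notation C := R[i].
Variables (p q k n N : nat) (Xi : {linear 'M[C]_p -> 'M[C]_q}) (V : 'M[C]_(k * n, N)).

Definition output_map (X : 'M[C]_(p * N)) : 'M[C]_(q * k) := tmap Xi (Psi V) X.

Lemma output_map_entry X s i t j :
  output_map X (mxtens_index (s, i)) (mxtens_index (t, j)) =
  \sum_a \sum_b Xi (delta_mx a b) s t * Psi V (mxblock X a b) i j.
Proof.
rewrite summxE; apply: eq_bigr => a _; rewrite summxE; apply: eq_bigr => b _.
by rewrite tensmxE.
Qed.

Lemma Psi_linear : linear (Psi V).
Proof.
move=> c X Y; rewrite !Psi_kraus scaler_sumr -big_split; apply: eq_bigr => l _ /=.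
by rewrite mulmxDr mulmxDl -scalemxAr -scalemxAl.
Qed.

Lemma output_map_linear : linear output_map.
Proof.
move=> c X Y; rewrite /output_map /tmap scaler_sumr -big_split; apply: eq_bigr => a _ /=.
rewrite scaler_sumr -big_split; apply: eq_bigr => b _ /=.
have -> : mxblock (c *: X + Y) a b = c *: mxblock X a b + mxblock Y a b.
  by apply/matrixP=> x y; rewrite !mxE.
rewrite Psi_linear; move: (Psi V _) (Psi V _) (Xi _) => Y1 Y2 Z.
by apply: matrix_tensP => s i t j; rewrite tensmxE !mxE !mxtens_indexK mulrDr mulrCA.
Qed.

HB.instance Definition _ :=
  GRing.isLinear.Build C 'M[C]_(p * N) 'M[C]_(q * k) *:%R output_map output_map_linear.

Hypothesis cpXi : completely_positive Xi.

(** The map factors as [(Xi (x) id)(id (x) Psi)]: the second factor is positive by its Kraus form,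
    the first by complete positivity between two exchanges of tensor factors. *)
Lemma psd_output_map X : psd X -> psd (output_map X).
Proof.
move=> pX; pose Y := \sum_l kraus_blocks (slice_mx V l) X.
have pY : psd Y by apply: psd_sum => l; exact: psd_kraus_blocks.
have blk a b : mxblock Y a b = Psi V (mxblock X a b).
  rewrite Psi_kraus; apply/matrixP=> i j; rewrite mxE !summxE.
  by apply: eq_bigr => l _; rewrite mxblock_entry block_mx_ofK.
suff -> : output_map X = swap_tens (tmap id Xi (swap_tens Y)).
  exact/psd_swap_tens/cpXi/psd_swap_tens.
apply: matrix_tensP => s i t j; rewrite output_map_entry mxE !mxtens_indexK /=.
rewrite mxblock_entry tmap_idE [mxblock _ i j]matrix_sum_delta linear_sum summxE.
apply: eq_bigr => a _; rewrite linear_sum summxE; apply: eq_bigr => b _.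
by rewrite linearZ !mxE !mxtens_indexK /= mxblock_entry blk mxE mulrC.
Qed.

Hypothesis tpXi : trace_preserving Xi.
Hypothesis isoV : adjmx V *m V = 1%:M.

Lemma trace_Psi X : \tr (Psi V X) = \tr X.
Proof.
rewrite -[Psi V X]mul1mx /Psi trace_ptrace2.
have -> : (1%:M : 'M[C]_k) *t (1%:M : 'M[C]_n) = 1%:M.
  by apply: matrix_tensP => i j l t; rewrite tensmxE !mxE -natrM mulnb
    (inj_eq (can_inj (@mxtens_indexK _ _))).
by rewrite mul1mx mxtrace_mulC mulmxA isoV mul1mx.
Qed.

Lemma trace_output_map X : \tr (output_map X) = \tr X.
Proof.
transitivity (\sum_a \sum_b \tr (Xi (delta_mx a b)) * \tr (Psi V (mxblock X a b))).
  rewrite /mxtrace big_mxtens.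
  under eq_bigr do under eq_bigr do rewrite output_map_entry.
  under eq_bigr do rewrite exchange_big /=.
  rewrite exchange_big /=; apply: eq_bigr => a _.
  under eq_bigr do rewrite exchange_big /=.
  rewrite exchange_big /=; apply: eq_bigr => b _.
  rewrite mulr_suml; apply: eq_bigr => s _.
  by rewrite mulr_sumr.
rewrite [RHS]/mxtrace big_mxtens; apply: eq_bigr => a _.
have tr_delta b : \tr (delta_mx a b : 'M[C]_p) = (b == a)%:R.
  rewrite /mxtrace (bigD1 a)//= big1 ?mxE ?eqxx ?addr0 1?eq_sym// => c ca.
  by rewrite mxE (negbTE ca).
rewrite (bigD1 a)//= big1 => [|b ba]; last by rewrite tpXi tr_delta (negbTE ba) mul0r.
rewrite tpXi tr_delta eqxx mul1r addr0 trace_Psi.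
by apply: eq_bigr => c _; rewrite mxE.
Qed.

Lemma density_output_map : output_map @` @density R (p * N) `<=` @density R (q * k).
Proof.
by move=> _ [X [pX tX] <-]; split; [exact: psd_output_map | rewrite trace_output_map].
Qed.

End OutputMap.

(** * Support functions of the output sets *)

Section SupportFunction.
Variable R : realType.
Local Notation C := R[i].

(** The rank condition gives [V] a left inverse [B]; multiplying [P P = P] by [B] and its adjoint
    leaves [V^* V = 1]. *)
Lemma isometry_of_proj m N (P : 'M[C]_m) (V : 'M[C]_(m, N)) :
  orth_proj P -> \rank P = N -> P = V *m adjmx V -> adjmx V *m V = 1%:M.
Proof.
move=> [_ PP] rP PE; have : row_full V.
  by rewrite -col_leq_rank -[X in (X <= _)%N]rP PE mxrankM_maxl.
move=> /row_fullP[B BV].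
have VB : adjmx V *m adjmx B = 1%:M by rewrite -adjmxM BV adjmx1.
have : B *m (P *m P) *m adjmx B = B *m P *m adjmx B by rewrite PP.
by rewrite PE !mulmxA BV mul1mx -!mulmxA VB mulmx1.
Qed.

(** * The support function at a fixed [n] as a norm *)

Section OneDimension.
Variables (p q k n N : nat) (Xi : {linear 'M[C]_p -> 'M[C]_q}).
Variables (P : 'M[C]_(k * n)) (V : 'M[C]_(k * n, N)) (A : 'M[C]_(q * k)).
Hypotheses (cpXi : completely_positive Xi) (hA : hermitian A).
Hypotheses (hP : hermitian P) (PE : P = V *m adjmx V) (isoV : adjmx V *m V = 1%:M).

Definition coef_poly (B : 'M[C]_k) : ncpoly C (option ('I_k * 'I_k)) :=
  ncsum [seq NCMul (NCConst (B ij.1 ij.2)) (NCVar (Some ij)) | ij <- enum {: 'I_k * 'I_k}].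

(** The indices in [delta_mx b a] are swapped because entry [(a, b)] of the form pairs with block
    [(b, a)] of the dyad [w w^*]. *)
Definition compressed_poly (a b : 'I_p) : ncpoly C (option ('I_k * 'I_k)) :=
  NCMul (NCVar None)
    (NCMul (coef_poly (contract_mx A (Xi (delta_mx b a)))) (NCVar None)).

Lemma nceval_coef_poly B :
  nceval (ptuple P) (coef_poly B) = B *t (1%:M : 'M[C]_n).
Proof.
rewrite nceval_ncsum big_enum /=; apply: matrix_tensP => i c j e.
rewrite tensmxE summxE (bigD1 (i, j))//= mul_scalar_mx mxE tensmxE mxE !eqxx mul1r.
rewrite big1 ?addr0// => -[a b] /= ab; rewrite mul_scalar_mx mxE tensmxE mxE.
by move: ab; rewrite xpair_eqE (eq_sym a) (eq_sym b) => /negbTE->; rewrite mul0r mulr0.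
Qed.

Local Notation T := (nceval_mx (ptuple P) compressed_poly).

Lemma mxblock_compressed a b : mxblock T a b =
  P *m (contract_mx A (Xi (delta_mx b a)) *t (1%:M : 'M[C]_n)) *m P.
Proof. by rewrite block_mx_ofK /= nceval_coef_poly mulmxA. Qed.

Lemma adjmx_tens1 (B : 'M[C]_k) : adjmx (B *t (1%:M : 'M[C]_n)) = adjmx B *t 1%:M.
Proof.
apply: matrix_tensP => i c j e; rewrite mxE !tensmxE !mxE rmorphM rmorph_nat.
by rewrite eq_sym.
Qed.

Lemma hermitian_compressed : hermitian T.
Proof.
apply/hermitian_blocksP => a b; rewrite !mxblock_compressed !adjmxM adjmx_tens1 hP.
by rewrite adjmx_contract_mx// cp_adjmx_delta// mulmxA.
Qed.

Lemma form_compressed (v : 'cV[C]_(p * (k * n))) :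
  let w := cat_cV (fun a => adjmx V *m block_cV v a) in
  frob v (T *m v) = frob A (output_map Xi V (w *m adjmx w)).
Proof.
move=> w; rewrite frob_blocks [RHS]/frob hA [output_map _ _ _]exchange_big /=.
rewrite mulmx_sumr Re_trace_sum; apply: eq_bigr => a _.
rewrite /frob block_mulmx_cV !mulmx_sumr !Re_trace_sum.
apply: eq_bigr => b _; congr Re; rewrite -trace_contract_mx trace_ptrace2.
rewrite mxblock_compressed mxblock_dyad !block_cat_cV adjmxM adjmxK PE.
move: (contract_mx _ _ *t _) (block_cV v a) (block_cV v b) => D x y.
have := mxtrace_mulC (adjmx x *m V *m adjmx V) (D *m V *m adjmx V *m y).
by rewrite !mulmxA.
Qed.

Lemma hsnorm_adj_iso (x : 'cV[C]_(k * n)) : hsnorm (adjmx V *m x) <= hsnorm x.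
Proof.
set y := adjmx V *m x; have Vy : hsnorm (V *m y) = hsnorm y.
  by rewrite !hsnormE frob_mulmx mulmxA isoV mul1mx.
have [y0|yn] := eqVneq (hsnorm y) 0; first by rewrite y0 hsnorm_ge0.
have yp : 0 < hsnorm y by rewrite lt_def yn hsnorm_ge0.
rewrite -(ler_pM2l yp) -expr2 sqr_hsnorm {2}/y frob_mulmx adjmxK.
by rewrite (le_trans (frob_CS _ _))// Vy.
Qed.

(** A state is a sum of dyads, and each vector lifts through the isometry [1 (x) V] without change
    of length. *)
Lemma support_le_opnorm X : density X -> frob A (output_map Xi V X) <= opnorm T.
Proof.
move=> [pX tX]; rewrite -[leRHS]mulr1 -[X in _ * X]/(Re (1 : C)) -tX.
have [x ->] := psd_sum_dyads pX.
rewrite linear_sum /= /frob mulmx_sumr !Re_trace_sum mulr_sumr.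
apply: ler_sum => l _; rewrite trace_dyad /= -/(frob _ _).
pose v := cat_cV (fun a => V *m block_cV (x l) a).
have vx a : adjmx V *m block_cV v a = block_cV (x l) a.
  by rewrite block_cat_cV mulmxA isoV mul1mx.
have xE : x l = cat_cV (fun a => adjmx V *m block_cV v a).
  apply/matrixP => i j; case: (mxtens_indexP i) => a c.
  by rewrite mxE mxtens_indexK /= vx mxE (ord1 j).
have vv : frob v v = frob (x l) (x l).
  rewrite !frob_blocks; apply: eq_bigr => a _.
  by rewrite block_cat_cV frob_mulmx mulmxA isoV mul1mx.
rewrite {1 2}xE -form_compressed (le_trans (frob_CS _ _))// -vv -sqr_hsnorm expr2 mulrC mulrA.
by rewrite ler_wpM2r ?hsnorm_ge0 ?opnorm_bound.
Qed.

Lemma psd_compressed : (forall W : 'M[C]_(q * k), psd W -> 0 <= frob A W) -> psd T.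
Proof.
move=> A0; apply: psdP => [|v]; first exact: hermitian_compressed.
by rewrite form_compressed A0//; exact/psd_output_map/psd_dyad.
Qed.

(** A vector whose form exceeds [s] is carried to [w] by [1 (x) V^*], which does not increase
    length, so the normalised dyad of [w] is the required state. *)
Lemma opnorm_le_support s : (forall W : 'M[C]_(q * k), psd W -> 0 <= frob A W) ->
  0 <= s -> s < opnorm T ->
  exists2 X, density X & s <= frob A (output_map Xi V X).
Proof.
move=> A0 s0 sT.
have [v hv] : exists v : 'cV[C]_(p * (k * n)), s * frob v v < frob v (T *m v).
  apply: contrapT => h; move: sT; rewrite ltNge; apply/negP/negPn.
  apply: opnorm_psd_le => // [|v]; first exact: psd_compressed.
  by rewrite leNgt; apply/negP => lt; apply: h; exists v.
move: hv; rewrite form_compressed; set w := cat_cV _ => hv.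
have wv : frob w w <= frob v v.
  rewrite !frob_blocks; apply: ler_sum => a _; rewrite block_cat_cV -!sqr_hsnorm.
  by rewrite ler_sqr ?nnegrE ?hsnorm_ge0 ?hsnorm_adj_iso.
have {}hv : s * frob w w < frob A (output_map Xi V (w *m adjmx w)).
  by rewrite (le_lt_trans _ hv)// ler_wpM2l.
have wn : frob w w != 0.
  apply/eqP => w0; move: hv; rewrite w0.
  have -> : w = 0 by apply: hsnorm_eq0; rewrite hsnormE w0 sqrtr0.
  by rewrite mul0mx linear0 /frob mulmx0 raddf0 mulr0 ltxx.
have wp : 0 < frob w w by rewrite lt_def wn frob_ge0.
exists (((frob w w)^-1)%:C%C *: (w *m adjmx w)); first split.
- apply: psdP => [|x]; first by rewrite /Defs.hermitian adjmxZ conjc_real hermitian_dyad.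
  by rewrite -scalemxAl frobZr mulr_ge0 ?invr_ge0 ?frob_ge0// psd_form_ge0//; exact: psd_dyad.
- by rewrite mxtraceZ trace_dyad -rmorphM mulVf.
- by rewrite linearZ frobZr mulrC ler_pdivlMr// ltW.
Qed.

End OneDimension.

(** The norm bounds the support function from above at [n] and is nearly attained at [l]; the Cauchy
    property of the norms links the two. *)
Lemma support_cauchy_outputs (k : nat) (N : nat -> nat)
    (P : forall n, 'M[C]_(k * n)) (V : forall n, 'M[C]_(k * n, N n)) p q
    (Xi : {linear 'M[C]_p -> 'M[C]_q}) :
  (forall n, hermitian (P n)) -> (forall n, P n = V n *m adjmx (V n)) ->
  (forall n, adjmx (V n) *m V n = 1%:M) ->
  strong_conv (fun n => ptuple (P n)) ->
  completely_positive Xi -> trace_preserving Xi ->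
  support_cauchy (fun n => output_map Xi (V n) @` @density R (p * N n)).
Proof.
move=> hP PE isoV cv cpXi tpXi A hA eta eta0.
(* Shifting A by c makes it dominate the identity, so that the support function
   of K_n at A1 is a norm, and is at least 1 unless K_n is empty. *)
pose c := hsnorm A + 1; pose A1 := A + c%:C%C *: 1%:M.
have hA1 : hermitian A1 by rewrite /Defs.hermitian adjmxD adjmxZ adjmx1 conjc_real hA.
have A1E W : frob A1 W = frob A W + c * Re (\tr W).
  by rewrite frobDl frobZl /frob adjmx1 mul1mx.
have A1ge W : psd W -> Re (\tr W) <= frob A1 W.
  move=> pW; rewrite A1E; have := hsnorm_psd pW.
  have := frob_CS (- A) W; rewrite frobNl hsnormN.
  have := hsnorm_ge0 W; have := hsnorm_ge0 A; rewrite /c => a0 w0 h1 h2.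
  have := ler_wpM2l a0 h2; lra.
have A10 W : psd W -> 0 <= frob A1 W.
  move=> pW; apply: le_trans (A1ge W pW); apply: le_trans (hsnorm_psd pW).
  exact: hsnorm_ge0.
(* The error [eps] occurs twice, in comparing the norms and in nearly attaining one. As the norm at
   [n] is at least [1], [eps <= 1 / 2] keeps [Tl - eps] nonnegative. *)
pose eps := Num.min (eta / 2) (1 / 2).
have eps0 : 0 < eps by rewrite lt_min !divr_gt0.
have [N0 hN0] := strong_conv_block_norm cv
  (fun n => psd_compressed cpXi hA1 (hP n) (PE n) A10) eps0.
exists N0 => n l hn hl _ [X dX <-].
have dW := density_output_map cpXi tpXi (isoV n) (imageP (output_map Xi (V n)) dX).
have up := support_le_opnorm Xi hA1 (PE n) (isoV n) dX.
have lo := A1ge _ dW.1; rewrite dW.2 /= in lo.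
have cau := hN0 n l hn hl.
have eps2 : eps <= 1 / 2 by rewrite ge_min lexx orbT.
have epse : eps <= eta / 2 by rewrite ge_min lexx.
set Tn := opnorm _ in up cau; set Tl := opnorm _ in cau.
clearbody eps; have s0 : 0 <= Tl - eps by lra.
have sT : Tl - eps < Tl by lra.
have [Y dY hY] := opnorm_le_support cpXi hA1 (hP l) (PE l) (isoV l) A10 s0 sT.
exists (output_map Xi (V l) Y); first by exists Y.
have dWl := density_output_map cpXi tpXi (isoV l) (imageP (output_map Xi (V l)) dY).
(* Both outputs have trace one, so the shift adds the same [c] on both sides. *)
move: up hY; rewrite !A1E dW.2 dWl.2 /=.
by move: (frob A _) (frob A _) => x y; lra.
Qed.

Lemma convexM_image m r (f : {linear 'M[C]_m -> 'M[C]_r}) (K : set 'M[C]_m) :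
  convexM K -> convexM (f @` K).
Proof.
move=> vK _ _ t [X KX <-] [Y KY <-] t0 t1.
by exists (t%:C%C *: X + (1 - t)%:C%C *: Y); [exact: vK | rewrite linearD !linearZ].
Qed.

End SupportFunction.

(** * Convergence of the output sets *)

Theorem theorem8p1 (R : realType) (k : nat) (N : nat -> nat)
    (P : forall n, 'M[R[i]]_(k * n)) (V : forall n, 'M[R[i]]_(k * n, N n)) :
  (forall n, orth_proj (P n)) ->
  (forall n, \rank (P n) = N n) ->
  (forall n, P n = V n *m adjmx (V n)) ->
  strong_conv (fun n => ptuple (P n)) ->
  forall (p q : nat) (Xi : {linear 'M[R[i]]_p -> 'M[R[i]]_q}),
    completely_positive Xi -> trace_preserving Xi ->
    exists K : set 'M[R[i]]_(q * k),
      [/\ compactM K, convexM K, K `<=` @density R (q * k) &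
       let Kn := fun n => tmap Xi (Psi (V n)) @` @density R (p * N n) in
       [/\ relint K `<=` set_liminf Kn,
           set_liminf Kn `<=` set_limsup Kn &
           set_limsup Kn `<=` K]].
Proof.
move=> hP rP PE cv p q Xi cpXi tpXi.
have isoV n : adjmx (V n) *m V n = 1%:M := isometry_of_proj (hP n) (rP n) (PE n).
have compK n : compactM (output_map Xi (V n) @` @density R (p * N n)).
  exact/image_compactM/density_compactM.
have convK n : convexM (output_map Xi (V n) @` @density R (p * N n)).
  exact/convexM_image/density_convexM.
have densK n : output_map Xi (V n) @` @density R (p * N n) `<=` @density R (q * k).
  exact: density_output_map.
apply: (hausdorff_cauchy_limit compK convK densK).
apply: (support_cauchy_hausdorff compK convK densK).
by apply: (support_cauchy_outputs (P := P)) => // n; exact: (hP n).1.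
Qed.
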